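(* Let $\omega$ be a radial weight. Then the following conditions are equivalent: (i) $\omega\in\widehat{\mathcal{D}}$; (ii) for any analytic self-map $\varphi$ of $\mathbb{D}$, there exist constants $M=M(\varphi,\omega)>0$ and $r_0=r_0(\varphi)\in(0,1)$ such that $N_{\varphi,\omega^\star}(z)\le M\omega^\star(z)$ for $|z|\ge r_0$; (iii) there exist an automorphism $\varphi_a(z)=\frac{a-z}{1-\overline{a}z}$ of $\mathbb{D}$ and constants $M=M(a,\omega)>0$ and $r_0=r_0(a)\in(0,1)$ such that $N_{\varphi_a,\omega^\star}(z)\le M\omega^\star(z)$ for $|z|\ge r_0$.
   Context: $\mathbb{D}=\{z:|z|<1\}$ is the open unit disc in the complex plane. A weight is a nonnegative integrable function on $\mathbb{D}$; it is radial if it depends only on $|z|$. For a radial weight $\omega$, $\widehat{\omega}(r)=\int_r^1\omega(s)\,ds$ for $0\le r<1$. $\widehat{\mathcal{D}}$ is the class of radial weights $\omega$ for which there is a constant $C>0$ with $\widehat{\omega}(r)\le C\,\widehat{\omega}\left(\frac{1+r}{2}\right)$ for all $0\le r<1$. The associated weight is $\omega^\star(z)=\int_{|z|}^1\omega(s)\log\frac{s}{|z|}\,s\,ds$ for $z\in\mathbb{D}\setminus\{0\}$. For an analytic self-map $\varphi$ of $\mathbb{D}$, the generalized Nevanlinna counting function is $N_{\varphi,\omega^\star}(z)=\sum_{\zeta\in\varphi^{-1}(z)}\omega^\star(\zeta)$ for $z\in\mathbb{D}\setminus\{\varphi(0)\}$, where each preimage $\zeta$ of $z$ is repeated according to its 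multiplicity.
   Formalization: It is assumed that 0 < ω̂(r) < ∞ for all 0 ≤ r < 1, and a ≠ 0 in (iii); otherwise the equivalence fails (ω the indicator of |z| ≤ 1/4, or ω = |z|^(-3/2); for a = 0, N equals ω*, so (iii) always holds). Weights are Borel measurable. *)

(* Defs.v *)
From HB Require Import structures.
From mathcomp Require Import all_boot all_order all_algebra.
From mathcomp Require Export complex.
From mathcomp Require Import all_classical all_reals all_analysis.
Set Implicit Arguments.
Unset Strict Implicit.
Unset Printing Implicit Defensive.
Import Order.TTheory GRing.Theory Num.Theory.
Import numFieldNormedType.Exports.
Local Open Scope classical_set_scope.
Local Open Scope ring_scope.
Local Open Scope complex_scope.

(* The next three definitions are over a numFieldType K, to be used with
   K = R[i], so as to have the topology given by the norm of K. *)
Definition taylor_at (K : numFieldType) (f : K -> K) (z : K) (a : nat -> K) :=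
  \forall w \near z, series (fun n => a n * (w - z) ^+ n) @ \oo --> f w.

Definition analytic_at (K : numFieldType) (f : K -> K) (z : K) :=
  exists a : nat -> K, taylor_at f z a.

(* The order of vanishing of f - f z at z, i.e. the multiplicity of z as a
   preimage of f z. When f is locally constant at z the set is empty and the
   value is the dummy 0. *)
Definition multiplicity (K : numFieldType) (f : K -> K) (z : K) : nat :=
  xget 0%N [set m : nat | (0 < m)%N /\ exists a : nat -> K,
    [/\ taylor_at f z a, a m != 0 & forall n, (0 < n < m)%N -> a n = 0]].

Section Defs.
Context {R : realType}.
Implicit Types (omega : R[i] -> R) (phi : R[i] -> R[i]) (z : R[i]).

Definition modulus (z : R[i]) : R := ComplexField.Normc.normc z.

Definition disc : set R[i] := [set z | modulus z < 1].

Definition analytic_self_map phi :=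
  forall z, disc z -> disc (phi z) /\ analytic_at phi z.

Definition moebius (a z : R[i]) : R[i] := (a - z) / (1 - a^* * z).

(* Functions on the disc are total functions on R[i] whose values outside the
   disc are irrelevant. Integrability is with respect to area measure, R[i]
   being identified with R * R. *)
Definition weight omega :=
  (forall z, disc z -> 0 <= omega z) /\
  (lebesgue_measure \x lebesgue_measure)%E.-integrable
    [set p : R * R | disc (p.1 +i* p.2)]
    (fun p => (omega (p.1 +i* p.2))%:E).

Definition radial omega :=
  forall z w, disc z -> disc w -> modulus z = modulus w -> omega z = omega w.

Definition radial_weight omega := weight omega /\ radial omega.

Definition hat omega (r : R) : \bar R :=
  (\int[lebesgue_measure]_(s in `[r, 1%R[) (omega s%:C)%:E)%E.

(* Integrability over the disc controls s * omega s, so it does not make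
   [hat omega 0] finite, nor does it prevent omega from vanishing a.e. near the
   unit circle. That hat omega takes its values in (0, +oo) is the usual
   standing assumption on radial weights. *)
Definition hat_nondegenerate omega :=
  forall r : R, 0 <= r < 1 -> (0 < hat omega r < +oo)%E.

Definition Dhat omega :=
  radial_weight omega /\
  exists2 C : R, 0 < C & forall r : R, 0 <= r < 1 ->
    (hat omega r <= C%:E * hat omega ((1 + r) / 2))%E.

(* Meaningful for 0 < |z| < 1. *)
Definition star omega z : \bar R :=
  (\int[lebesgue_measure]_(s in `[modulus z, 1%R[)
     (omega s%:C * ln (s / modulus z) * s)%:E)%E.

(* Meaningful for z in the disc other than phi 0. For such z the map phi is not
   constant if z has a preimage, so that all multiplicities are positive. *)
Definition nevanlinna_counting phi (u : R[i] -> \bar R) z : \bar R :=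
  (\esum_(zeta in [set zeta | disc zeta /\ phi zeta = z])
     ((multiplicity phi zeta)%:R%:E * u zeta))%E.

Definition counting_bound phi omega (M r0 : R) :=
  forall z, disc z -> z != phi 0 -> r0 <= modulus z ->
    (nevanlinna_counting phi (star omega) z <= M%:E * star omega z)%E.

End Defs.

(* Main.v *)
Require Import Defs.
From HB Require Import structures.
From mathcomp Require Import all_boot all_order all_algebra.
From mathcomp Require Import all_classical all_reals all_analysis.
From mathcomp Require Import measurable_realfun ring lra.
Set Implicit Arguments.
Unset Strict Implicit.
Unset Printing Implicit Defensive.
Import Order.TTheory GRing.Theory Num.Theory.
Import numFieldNormedType.Exports.
Local Open Scope classical_set_scope.
Local Open Scope ring_scope.

(* (i) => (ii). If z <> phi 0 and zeta ranges over finitely many preimages of z,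
   of multiplicities m, then w |-> moebius z (phi w) divided by the finite
   Blaschke product of the zeta is bounded by 1 on the disc, by the maximum
   principle. At w = 0 this is Littlewood's inequality
     rho := |moebius z (phi 0)| <= prod |zeta| ^ m.
   Since star omega zeta <= ln (1 / |zeta|) * hat omega |zeta| and
   |zeta| >= rho, the counting function is at most ln (1 / rho) * hat omega rho.
   As 1 - rho <= K (1 - |z|), the doubling condition bounds this by a multiple of
   (1 - |z|) * hat omega ((1 + |z|) / 2), hence of star omega z.

   (iii) => (i). If |z| = 1 - t and z lies on the ray through a, then the
   preimage of z under moebius a has modulus at most 1 - (1 + |a|) t. As star
   omega is radially decreasing, iterating gives
   star omega (1 - 4 t) <= C * star omega (1 - t), and both sides are comparable
   to t times values of hat omega.

   The maximum principle only needs second order expansions at each point, which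
   spares the theory of analytic functions: if F (p + h) = c0 + c1 h + c2 h^2 +
   O(h^3), then |F|^2 + d |.|^2 has no local maximum at p, for d > 0. *)

(** * Modulus and Taylor expansions *)

Section Modulus.
Context {R : realType}.
Implicit Types (z w : R[i]) (x y r : R).

Lemma normE z : `|z| = (modulus z)%:C%C.
Proof. by []. Qed.

Lemma modulus_ge0 z : 0 <= modulus z.
Proof. by case: z => a b; exact: sqrtr_ge0. Qed.

Lemma modulus0 : modulus (0 : R[i]) = 0.
Proof. exact: ComplexField.Normc.normc0. Qed.

Lemma modulus1 : modulus (1 : R[i]) = 1.
Proof. exact: ComplexField.Normc.normc1. Qed.

Lemma modulus_eq0 z : (modulus z == 0) = (z == 0).
Proof.
by apply/eqP/eqP => [/ComplexField.Normc.eq0_normc//|->]; exact: modulus0.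
Qed.

Lemma modulus_gt0 z : (0 < modulus z) = (z != 0).
Proof. by rewrite lt0r modulus_eq0 modulus_ge0 andbT. Qed.

Lemma modulusM z w : modulus (z * w) = modulus z * modulus w.
Proof. exact: ComplexField.Normc.normcM. Qed.

Lemma modulusV z : modulus z^-1 = (modulus z)^-1.
Proof. exact: ComplexField.Normc.normcV. Qed.

Lemma modulusX z n : modulus (z ^+ n) = modulus z ^+ n.
Proof.
by elim: n => [|n IH]; rewrite ?expr0 ?modulus1// !exprS modulusM IH.
Qed.

Lemma modulusD z w : modulus (z + w) <= modulus z + modulus w.
Proof. exact: le_normcD. Qed.

Lemma modulusN z : modulus (- z) = modulus z.
Proof. exact: normcN. Qed.

Lemma modulusB_sym z w : modulus (z - w) = modulus (w - z).
Proof. by rewrite -modulusN opprB. Qed.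

Lemma modulusB_ge z w : modulus z - modulus w <= modulus (z - w).
Proof. by rewrite lerBlDr -{1}(subrK w z) modulusD. Qed.

Lemma modulus_real x : modulus (x%:C%C : R[i]) = `|x|.
Proof. by rewrite /modulus /= expr0n addr0 sqrtr_sqr. Qed.

Lemma modulus_conj z : modulus z^*%C = modulus z.
Proof. by case: z => a b; rewrite /modulus /= sqrrN. Qed.

Lemma sqr_modulus z : modulus z ^+ 2 = complex.Re z ^+ 2 + complex.Im z ^+ 2.
Proof. by case: z => a b; rewrite /modulus /= sqr_sqrtr// addr_ge0// sqr_ge0. Qed.

Lemma modulus_prod (I : Type) (s : seq I) (f : I -> R[i]) :
  modulus (\prod_(i <- s) f i) = \prod_(i <- s) modulus (f i).
Proof. by apply: (big_morph _ modulusM modulus1). Qed.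

Lemma modulus_sum (I : Type) (s : seq I) (P : pred I) (f : I -> R[i]) :
  modulus (\sum_(i <- s | P i) f i) <= \sum_(i <- s | P i) modulus (f i).
Proof.
elim/big_ind2 : _ => [|z x w y zx wy|//]; first by rewrite modulus0.
by rewrite (le_trans (modulusD _ _))// lerD.
Qed.

Local Notation C := (R[i] : numFieldType).

Lemma nbhs_modulus (P : R[i] -> Prop) z : (\forall w \near (z : C), P w) <->
  exists2 r : R, 0 < r & forall w, modulus (w - z) < r -> P w.
Proof.
split=> [/nbhs_ballP[[e1 e2] /=]|[r r0 rP]].
  rewrite ltcE /= => /andP[/eqP-> e0] eP; exists e1 => // w wz; apply: eP.
  by rewrite -ball_normE /= distrC normE ltcR.
apply/nbhs_ballP; exists (r%:C%C) => /=; first by rewrite ltcR.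
by move=> w; rewrite -ball_normE /= distrC normE ltcR; exact: rP.
Qed.

Lemma cvg_modulus (u : nat -> C) (l : C) : u @ \oo --> l <->
  forall e : R, 0 < e -> \forall n \near \oo, modulus (u n - l) < e.
Proof.
split=> [ul e e0|ul].
  have /cvgrPdist_lt/(_ (e%:C%C)) := ul; rewrite ltcR => /(_ e0).
  by apply: filterS => n; rewrite distrC normE ltcR.
apply/cvgrPdist_lt => -[e1 e2]; rewrite ltcE /= => /andP[/eqP-> e0].
by have := ul _ e0; apply: filterS => n; rewrite distrC normE ltcR.
Qed.

End Modulus.

(** * Coefficient and remainder estimates for Taylor series *)

Section Taylor.
Context {R : realType}.
Implicit Types (f : R[i] -> R[i]) (z w : R[i]).

(* Cauchy estimates, obtained from convergence at one point other than z. *)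
Lemma taylor_coef_bound f z (a : nat -> R[i]) : taylor_at f z a ->
  exists r M : R, [/\ 0 < r, 0 <= M & forall n, modulus (a n) * r ^+ n <= M].
Proof.
move=> /nbhs_modulus[r r0 fa].
pose h := ((r / 2)%:C%C : R[i]).
have hE : modulus h = r / 2 by rewrite modulus_real gtr0_norm// divr_gt0.
have := fa (z + h); rewrite addrAC subrr add0r hE ltr_pdivrMr// ltr_pMr// ltr1n.
move=> /(_ isT)/cvgP/cvg_series_cvg_0/cvg_modulus/(_ _ ltr01)[N _ hN].
(* The terms of a convergent series tend to 0, so those from [N] on are below 1; the finite sum
   covers the earlier ones. *)
exists (r / 2), (1 + \sum_(n < N) modulus (a n) * (r / 2) ^+ n).
have s0 : 0 <= \sum_(n < N) modulus (a n) * (r / 2) ^+ n.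
  by apply: sumr_ge0 => i _; rewrite mulr_ge0 ?modulus_ge0// exprn_ge0// ltW// divr_gt0.
split; [by rewrite divr_gt0|by rewrite addr_ge0|move=> n].
have [nN|Nn] := ltnP n N.
  rewrite (bigD1 (Ordinal nN))//= addrCA lerDl addr_ge0// sumr_ge0// => i _.
  by rewrite mulr_ge0 ?modulus_ge0// exprn_ge0// ltW// divr_gt0.
have := hN n Nn; rewrite subr0 modulusM modulusX hE.
by move=> /ltW/le_trans; apply; rewrite lerDl.
Qed.

(** The coefficient bound compares the tail with a geometric series of ratio [q] = |h| / r. Halving
    the radius gives q <= 1/2, so the tail is at most 2 M q^N. *)
Lemma taylor_remainder f z (a : nat -> R[i]) N : taylor_at f z a ->
  exists r C : R, 0 < r /\ forall h, modulus h < r ->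
    modulus (f (z + h) - \sum_(0 <= n < N) a n * h ^+ n) <= C * modulus h ^+ N.
Proof.
move=> fa; have [r [M [r0 M0 aM]]] := taylor_coef_bound fa.
have /nbhs_modulus[r' r'0 fcv] := fa.
exists (Num.min r' (r / 2)), (2 * M / r ^+ N); split.
  by rewrite lt_min r'0 divr_gt0.
move=> h; rewrite lt_min => /andP[hr' hr].
have := fcv (z + h); rewrite addrAC subrr add0r => /(_ hr') cv.
set q := modulus h / r.
have q0 : 0 <= q by rewrite divr_ge0 ?modulus_ge0// ltW.
have q2 : q <= 2^-1 by rewrite ler_pdivrMr// mulrC ltW.
have rhs : 2 * M / r ^+ N * modulus h ^+ N = 2 * M * q ^+ N.
  by rewrite /q expr_div_n mulrAC !mulrA.
rewrite rhs; apply/ler_addgt0Pl => e e0.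
have [K _ hK] := (cvg_modulus _ _).1 cv _ e0.
have := hK (maxn K N) (leq_maxl _ _).
set L := maxn K N.
have -> : series (fun n => a n * h ^+ n) L = \sum_(0 <= n < N) a n * h ^+ n +
     \sum_(N <= n < L) a n * h ^+ n.
  by rewrite seriesEnat /= -big_cat_nat//= leq_maxr.
set S := \sum_(0 <= n < N) _; set T := \sum_(N <= n < L) _ => /ltW ST.
have TM : modulus T <= 2 * M * q ^+ N.
  rewrite (le_trans (modulus_sum _ _ _))//.
  (* The subtracted term makes the induction close: 2 q <= 1 gives q^j <= 2 q^j - 2 q^(j+1). *)
  have tail k : \sum_(N <= n < N + k) q ^+ n <= 2 * q ^+ N - 2 * q ^+ (N + k).
    elim: k => [|k IH]; first by rewrite addn0 big_geq// subrr.
    rewrite addnS big_nat_recr ?leq_addr//= exprS.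
    have := exprn_ge0 (N + k) q0; nra.
  have {tail} := tail (L - N)%N; rewrite subnKC ?leq_maxr// => tail.
  apply: (@le_trans _ _ (M * \sum_(N <= n < L) q ^+ n)).
    rewrite mulr_sumr ler_sum// => n _; rewrite modulusM modulusX /q expr_div_n.
    rewrite mulrA ler_pdivlMr ?exprn_gt0// mulrAC ler_wpM2r//.
    by rewrite exprn_ge0// modulus_ge0.
  rewrite mulrAC [leRHS]mulrC ler_wpM2l// (le_trans tail)// gerBl.
  by rewrite mulr_ge0// exprn_ge0.
have -> : f (z + h) - S = T - (S + T - f (z + h)) by ring.
rewrite (le_trans (modulusD _ _))// modulusN addrC lerD//.
Qed.

End Taylor.

(** * Second order expansions *)

Section Jet.
Context {R : realType}.
Implicit Types (f g e : R[i] -> R[i]) (p c h z w : R[i]).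

(** Excluding h = 0 allows quotients by powers of [h], whose value at 0 is only a default. *)
Definition bounded_near0 e := exists r C : R, 0 < r /\
  forall h, h != 0 -> modulus h < r -> modulus (e h) <= C.

(* [jet f p c]: f has a second order expansion with constant term c at p and
   remainder O(h^3). The value of f at p itself is not constrained. *)
Definition jet f p c := exists c1 c2 : R[i],
  bounded_near0 (fun h => (f (p + h) - (c + c1 * h + c2 * h ^+ 2)) / h ^+ 3).

Lemma bounded_near0_eq e e' (r : R) : 0 < r ->
  (forall h, h != 0 -> modulus h < r -> e h = e' h) ->
  bounded_near0 e -> bounded_near0 e'.
Proof.
move=> r0 ee' [s [C [s0 eC]]]; exists (Num.min r s), C; split.
  by rewrite lt_min r0.
by move=> h h0; rewrite lt_min => /andP[hr hs]; rewrite -ee'// eC.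
Qed.

Lemma bounded_near0_cst c : bounded_near0 (fun=> c).
Proof. by exists 1, (modulus c). Qed.

Lemma bounded_near0_id : bounded_near0 id.
Proof. by exists 1, 1; split=> // h _ /ltW. Qed.

Lemma bounded_near0D e e' : bounded_near0 e -> bounded_near0 e' ->
  bounded_near0 (fun h => e h + e' h).
Proof.
move=> [r [C [r0 eC]]] [r' [C' [r'0 eC']]].
exists (Num.min r r'), (C + C'); split; first by rewrite lt_min r0.
move=> h h0; rewrite lt_min => /andP[hr hr'].
by rewrite (le_trans (modulusD _ _))// lerD ?eC ?eC'.
Qed.

Lemma bounded_near0M e e' : bounded_near0 e -> bounded_near0 e' ->
  bounded_near0 (fun h => e h * e' h).
Proof.
move=> [r [C [r0 eC]]] [r' [C' [r'0 eC']]].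
exists (Num.min r r'), (C * C'); split; first by rewrite lt_min r0.
move=> h h0; rewrite lt_min => /andP[hr hr'].
by rewrite modulusM ler_pM ?modulus_ge0 ?eC ?eC'.
Qed.

Lemma jet_bounded f p c : jet f p c -> bounded_near0 (fun h => f (p + h)).
Proof.
move=> [c1 [c2 fb]]; have X := @bounded_near0_id.
have := bounded_near0D (bounded_near0D (bounded_near0D (bounded_near0_cst c)
    (bounded_near0M (bounded_near0_cst c1) X))
    (bounded_near0M (bounded_near0M (bounded_near0_cst c2) X) X))
  (bounded_near0M (bounded_near0M (bounded_near0M fb X) X) X).
by apply: (bounded_near0_eq ltr01) => h h0 _; field.
Qed.

Lemma jet_continuous f p c : jet f p c -> forall e : R, 0 < e ->
  exists2 r : R, 0 < r & forall h, h != 0 -> modulus h < r -> modulus (f (p + h) - c) < e.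
Proof.
move=> [c1 [c2 fb]].
have : bounded_near0 (fun h => (f (p + h) - c) / h).
  have := bounded_near0D (bounded_near0D (bounded_near0_cst c1)
     (bounded_near0M (bounded_near0_cst c2) bounded_near0_id))
  (bounded_near0M (bounded_near0M fb bounded_near0_id) bounded_near0_id).
  by apply: (bounded_near0_eq ltr01) => h h0 _; field.
move=> [r [C [r0 hC]]] e e0.
have C1 : 0 < `|C| + 1 by rewrite ltr_wpDl.
exists (Num.min r (e / (`|C| + 1))); first by rewrite lt_min r0 divr_gt0.
move=> h h0; rewrite lt_min ltr_pdivlMr// => /andP[hr he].
have := hC h h0 hr; rewrite modulusM modulusV ler_pdivrMr ?modulus_gt0//.
move=> /le_lt_trans; apply; apply: le_lt_trans he; rewrite mulrC.
by rewrite ler_wpM2l ?modulus_ge0// ler_wpDr// ler_norm.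
Qed.

Lemma jet_eq f g p c (r : R) : 0 < r ->
  (forall h, h != 0 -> modulus h < r -> f (p + h) = g (p + h)) ->
  jet f p c -> jet g p c.
Proof.
move=> r0 fg [c1 [c2 fb]]; exists c1, c2; apply: (bounded_near0_eq r0 _ fb) => h h0 hr.
by rewrite fg.
Qed.

Lemma jet_cst c p : jet (fun=> c) p c.
Proof.
exists 0, 0; apply: (bounded_near0_eq ltr01) (bounded_near0_cst 0) => h h0 _.
by field.
Qed.

Lemma jet_id p : jet id p p.
Proof.
exists 1, 0; apply: (bounded_near0_eq ltr01) (bounded_near0_cst 0) => h h0 _.
by field.
Qed.

Lemma jetD f g p c c' : jet f p c -> jet g p c' ->
  jet (fun w => f w + g w) p (c + c').
Proof.
move=> [c1 [c2 fb]] [c1' [c2' gb]]; exists (c1 + c1'), (c2 + c2').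
by apply: (bounded_near0_eq ltr01) (bounded_near0D fb gb) => h h0 _; field.
Qed.

Lemma jetM f g p c c' : jet f p c -> jet g p c' ->
  jet (fun w => f w * g w) p (c * c').
Proof.
move=> fj [c1' [c2' gb]]; have fb := jet_bounded fj; case: fj => c1 [c2 fb3].
exists (c * c1' + c1 * c'), (c * c2' + c1 * c1' + c2 * c').
have cst := bounded_near0_cst; have X := bounded_near0_id.
(* With P and P' the quadratic parts, f g - P P' = f (g - P') + (f - P) P'; the last summand
   collects the terms of P P' of degree 3 and 4. *)
have := bounded_near0D (bounded_near0M fb gb) (bounded_near0D
  (bounded_near0M fb3 (bounded_near0D (bounded_near0D (cst c')
     (bounded_near0M (cst c1') X)) (bounded_near0M (bounded_near0M (cst c2') X) X)))
  (bounded_near0D (cst (c1 * c2' + c2 * c1')) (bounded_near0M (cst (c2 * c2')) X))).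
by apply: (bounded_near0_eq ltr01) => h h0 _; field.
Qed.

Lemma jetN f p c : jet f p c -> jet (fun w => - f w) p (- c).
Proof.
move=> fj; have := jetM (jet_cst (-1) p) fj; rewrite mulN1r.
by apply: (jet_eq ltr01) => h _ _; rewrite mulN1r.
Qed.

Lemma jetB f g p c c' : jet f p c -> jet g p c' ->
  jet (fun w => f w - g w) p (c - c').
Proof. by move=> fj /jetN; exact: jetD. Qed.

Lemma jetX f p c n : jet f p c -> jet (fun w => f w ^+ n) p (c ^+ n).
Proof.
move=> fj; elim: n => [|n IH]; first exact: jet_cst.
rewrite exprS; apply: (jet_eq ltr01) (jetM fj IH) => h _ _.
by rewrite exprS.
Qed.

Lemma jetV f p c : c != 0 -> jet f p c -> jet (fun w => (f w)^-1) p c^-1.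
Proof.
move=> c0 fj; have c00 : 0 < modulus c / 2 by rewrite divr_gt0// modulus_gt0.
have [r r0 fr] := jet_continuous fj c00.
have fc h : h != 0 -> modulus h < r -> modulus c / 2 < modulus (f (p + h)).
  move=> h0 hr; have := fr h h0 hr; have := modulusB_ge c (f (p + h)).
  by rewrite modulusB_sym; lra.
have f0 h : h != 0 -> modulus h < r -> f (p + h) != 0.
  by move=> h0 hr; rewrite -modulus_gt0 (lt_trans c00)// fc.
have fV : bounded_near0 (fun h => (f (p + h))^-1).
  exists r, (modulus c / 2)^-1; split=> // h h0 hr.
  by rewrite modulusV lef_pV2 ?posrE// ?ltW ?fc// modulus_gt0 f0.
case: fj => c1 [c2 fb].
(* The coefficients of 1 / (c + c1 h + c2 h^2) up to order 2. The remainder is (1 - f (1/c + d1 h +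
   d2 h^2)) / f, whose numerator is O(h^3). *)
pose d1 := - c1 / c ^+ 2; pose d2 := (c1 ^+ 2 - c * c2) / c ^+ 3.
exists d1, d2.
have cst := bounded_near0_cst; have X := bounded_near0_id.
have := bounded_near0M fV (bounded_near0D
  (bounded_near0D (cst (- (d1 * c2 + d2 * c1))) (bounded_near0M (cst (- (d2 * c2))) X))
  (bounded_near0M fb (bounded_near0D (bounded_near0D (cst (- c^-1))
     (bounded_near0M (cst (- d1)) X)) (bounded_near0M (bounded_near0M (cst (- d2)) X) X)))).
apply: (bounded_near0_eq r0) => h h0 hr; rewrite /d1 /d2.
by field; rewrite c0 h0 f0.
Qed.

(** The remainder estimate with one term, taken at h = 0. *)
Lemma taylor_value f p (a : nat -> R[i]) : taylor_at f p a -> a 0%N = f p.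
Proof.
move=> /(@taylor_remainder _ _ _ _ 1%N)[r [C [r0]]] /(_ 0).
rewrite modulus0 => /(_ r0); rewrite big_nat1 expr0 mulr1 addr0 expr1 mulr0.
move=> H; apply/eqP; rewrite eq_sym -subr_eq0 -modulus_eq0.
by rewrite eq_le H modulus_ge0.
Qed.

(* Dividing out a zero of order m shifts the Taylor series. *)
Lemma taylor_jet_shift f p (a : nat -> R[i]) m : (0 < m)%N -> taylor_at f p a ->
  (forall n, (0 < n < m)%N -> a n = 0) ->
  jet (fun w => (f w - f p) / (w - p) ^+ m) p (a m).
Proof.
(* A remainder of order m + 3 is still O(h^3) after division by h^m. *)
move=> m0 fa a0; have [r [C [r0 fC]]] := @taylor_remainder _ _ _ _ (m + 3)%N fa.
exists (a m.+1), (a m.+2), r, C; split=> // h h0 hr.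
have := fC h hr; rewrite addnC /= (_ : (3 + m)%N = m.+3)//.
rewrite !big_nat_recr//= -(prednK m0) big_nat_recl//= expr0 mulr1 (taylor_value fa).
rewrite big_nat_cond big1 ?addr0 => [|n /andP[nm _]]; last first.
  by rewrite a0 ?mul0r//= -ltn_predRL.
rewrite prednK// => fCh.
rewrite modulusM modulusV modulusX ler_pdivrMr ?exprn_gt0 ?modulus_gt0//.
rewrite -(ler_pM2r (_ : 0 < modulus h ^+ m)) ?exprn_gt0 ?modulus_gt0//.
rewrite -mulrA -exprD -[modulus h ^+ m]modulusX -modulusM.
apply: le_trans fCh; rewrite le_eqVlt; apply/orP; left; apply/eqP.
congr modulus; have -> : p + h - p = h by rewrite addrC addKr.
rewrite !exprS.
by field; rewrite expf_neq0.
Qed.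

End Jet.

(** * The maximum principle *)

Section MaximumPrinciple.
Context {R : realType}.
Implicit Types (F : R[i] -> R[i]) (p c h z w : R[i]) (r t : R).

(** The reverse triangle inequality squared if |w| <= |z|; otherwise the left side is at most 0. *)
Lemma sqr_modulusD_ge z w :
  modulus z ^+ 2 - 2 * modulus z * modulus w <= modulus (z + w) ^+ 2.
Proof.
have [zw|wz] := leP (modulus w) (modulus z); last first.
  have := sqr_ge0 (modulus (z + w)); have := modulus_ge0 z; nra.
have := modulusB_ge z (- w); rewrite opprK modulusN => H.
have : (modulus z - modulus w) ^+ 2 <= modulus (z + w) ^+ 2.
  by rewrite ler_sqr ?nnegrE ?subr_ge0 ?modulus_ge0.
have := sqr_ge0 (modulus w); nra.
Qed.

Definition compass t : seq R[i] := [:: t%:C; (- t)%:C; t *i; (- t) *i]%C.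

(** Over the four points [h], h^2 and h * conj (h^2) all sum to 0, so the excess is 4 (|c1|^2 t^2 +
    |c2|^2 t^4). *)
Lemma sum_compass_quadratic c0 c1 c2 t :
  4 * modulus c0 ^+ 2 <=
  \sum_(h <- compass t) modulus (c0 + c1 * h + c2 * h ^+ 2) ^+ 2.
Proof.
rewrite !big_cons big_nil !sqr_modulus !expr2.
case: c0 c1 c2 => [a b] [a1 b1] [a2 b2] /=.
rewrite -subr_ge0; set X := (X in 0 <= X).
have -> : X = 4 * ((t * a1) ^+ 2 + (t * b1) ^+ 2 + (t ^+ 2 * a2) ^+ 2 + (t ^+ 2 * b2) ^+ 2).
  by rewrite /X; ring.
by apply: mulr_ge0 => //; do 3![apply: addr_ge0; last exact: sqr_ge0]; exact: sqr_ge0.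
Qed.

Lemma sum_compass_sqr_modulus p t :
  \sum_(h <- compass t) modulus (p + h) ^+ 2 = 4 * modulus p ^+ 2 + 4 * t ^+ 2.
Proof.
by rewrite !big_cons big_nil !sqr_modulus; case: p => a b /=; ring.
Qed.

Lemma mem_compass_modulus t h : 0 < t -> h \in compass t -> modulus h = t.
Proof.
move=> t0; rewrite !inE => /or4P[] /eqP->;
 rewrite /modulus /= ?expr0n/= ?addr0 ?add0r sqrtr_sqr ?normrN gtr0_norm//.
Qed.

(* Averaging over the four points p + t, p - t, p + it, p - it kills the mixed
   terms of the expansion of |F|^2 up to order 2, so that the average exceeds
   the value at p by at least d t^2 - O(t^3). *)
Lemma jet_not_local_max F p (d : R) : 0 < d -> jet F p (F p) ->
  ~ exists2 r : R, 0 < r & forall h, modulus h < r ->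
    modulus (F (p + h)) ^+ 2 + d * modulus (p + h) ^+ 2 <=
    modulus (F p) ^+ 2 + d * modulus p ^+ 2.
Proof.
move=> d0 [c1 [c2 [r' [C [r'0 eC]]]]] [r r0 Fmax].
set c := F p in eC Fmax.
pose S := modulus c + modulus c1 + modulus c2.
have S0 : 0 <= S by rewrite !addr_ge0 ?modulus_ge0.
have SC : 0 < 2 * S * `|C| + 1 by rewrite ltr_wpDl// !mulr_ge0.
(* [m] keeps [t] within both radii, below 1 so that the quadratic part is at most [S], and small
   enough for the cubic error 2 S |C| t^3 to stay below the gain d t^2. *)
pose m := Num.min (Num.min r r') (Num.min 1 (d / (2 * S * `|C| + 1))).
have m0 : 0 < m by rewrite !lt_min r0 r'0 ltr01 divr_gt0.
pose t := m / 2.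
have t0 : 0 < t by rewrite divr_gt0.
have : t < m by rewrite ltr_pdivrMr// ltr_pMr// ltr1n.
rewrite !lt_min ltr_pdivlMr// => /andP[/andP[tr tr'] /andP[t1 td]].
have key h : h \in compass t ->
    modulus (c + c1 * h + c2 * h ^+ 2) ^+ 2 - 2 * S * `|C| * t ^+ 3 <=
    modulus (F (p + h)) ^+ 2.
  move=> ht; have hE := mem_compass_modulus t0 ht.
  have h0 : h != 0 by rewrite -modulus_gt0 hE.
  have := eC h h0; rewrite hE => /(_ tr').
  set e := _ / _ => eC'.
  have -> : F (p + h) = (c + c1 * h + c2 * h ^+ 2) + e * h ^+ 3.
    by rewrite /e; field.
  apply: le_trans (sqr_modulusD_ge _ _); rewrite lerB// modulusM modulusX hE.
  have PS : modulus (c + c1 * h + c2 * h ^+ 2) <= S.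
    rewrite (le_trans (modulusD _ _))// lerD//.
      rewrite (le_trans (modulusD _ _))// lerD// modulusM hE.
      by rewrite ler_piMr ?modulus_ge0// ltW.
    by rewrite modulusM modulusX hE ler_piMr ?modulus_ge0// exprn_ile1// ltW.
  rewrite mulrA ler_wpM2r ?(exprn_ge0 _ (ltW t0))// -!mulrA ler_wpM2l//.
  by rewrite ler_pM ?modulus_ge0// (le_trans eC')// ler_norm.
have := sum_compass_quadratic c c1 c2 t.
have := sum_compass_sqr_modulus p t.
have sC (a : R) : \sum_(h <- compass t) a = 4 * a.
  by rewrite !big_cons !big_nil; ring.
have : \sum_(h <- compass t) modulus (c + c1 * h + c2 * h ^+ 2) ^+ 2 -
    4 * (2 * S * `|C| * t ^+ 3) <= \sum_(h <- compass t) modulus (F (p + h)) ^+ 2.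
  by rewrite -sC -sumrB big_seq [leRHS]big_seq ler_sum.
have : \sum_(h <- compass t) modulus (F (p + h)) ^+ 2 +
    d * \sum_(h <- compass t) modulus (p + h) ^+ 2 <=
    4 * (modulus c ^+ 2 + d * modulus p ^+ 2).
  rewrite -sC mulr_sumr -big_split/= big_seq [leRHS]big_seq ler_sum// => h ht.
  by rewrite Fmax// (mem_compass_modulus t0 ht).
set A1 := \sum_(h <- _) modulus (F _) ^+ 2.
set A2 := \sum_(h <- _) modulus (p + h) ^+ 2.
set A3 := \sum_(h <- _) modulus (c + _ + _) ^+ 2.
have t2 : 0 < t ^+ 2 by rewrite exprn_gt0.
have : t * (2 * S * `|C| + 1) * t ^+ 2 < d * t ^+ 2 by rewrite ltr_pM2r.
have t3 : 0 < t ^+ 3 by rewrite exprn_gt0.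
have -> : t * (2 * S * `|C| + 1) * t ^+ 2 = 2 * S * `|C| * t ^+ 3 + t ^+ 3.
  by ring.
set X1 := modulus c ^+ 2; set X2 := 2 * S * `|C| * t ^+ 3; set X3 := t ^+ 3 in t3 *.
set Y := t ^+ 2; set Z := modulus p ^+ 2 => H1 H2 H3 H4 H5.
have : d * A2 = d * (4 * Z + 4 * Y) by rewrite H4.
lra.
Qed.

End MaximumPrinciple.

(** * The maximum principle on closed discs *)

Section MaximumModulus.
Context {R : realType}.
Implicit Types (F : R[i] -> R[i]) (p c h z w : R[i]) (r t : R).

Lemma modulus_le_sum (x y : R) : modulus (x +i* y)%C <= `|x| + `|y|.
Proof.
rewrite -[leRHS]ger0_norm ?addr_ge0// -sqrtr_sqr ler_wsqrtr// sqrrD.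
by rewrite !real_normK ?num_real// addrAC lerDl mulrn_wge0// mulr_ge0.
Qed.

(** Stated on [R * R], where the extreme value theorem is applied. *)
Lemma jet_modulus_continuous F (x y : R) :
  jet F (x +i* y)%C (F (x +i* y)%C) ->
  {for (x, y), continuous (fun q : R * R => modulus (F (q.1 +i* q.2)%C))}.
Proof.
move=> Fj; apply/cvgrPdist_lt => e e0.
have [r r0 rF] := jet_continuous Fj e0.
have r20 : 0 < r / 2 by rewrite divr_gt0.
have cf : (fun q : R * R => q.1) @ (x, y) --> x by exact: cvg_fst.
have cs : (fun q : R * R => q.2) @ (x, y) --> y by exact: cvg_snd.
move/cvgrPdist_lt : cf => /(_ _ r20); move/cvgrPdist_lt : cs => /(_ _ r20).
apply: filterS2 => -[x' y'] /= yr xr.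
pose h := ((x' - x) +i* (y' - y))%C.
have hr : modulus h < r.
  rewrite (le_lt_trans (modulus_le_sum _ _))// [`|x' - x|]distrC [`|y' - y|]distrC.
  by rewrite (splitr r) ltrD.
have -> : (x' +i* y' = x +i* y + h)%C by rewrite /h/=; simpc; rewrite !subrKC.
have [->|h0] := eqVneq h 0; first by rewrite addr0 subrr normr0.
apply: le_lt_trans (rF h h0 hr).
move: (F _) (F _) => u v; rewrite ler_norml; apply/andP; split.
  by rewrite lerNl opprB modulusB_ge.
by rewrite modulusB_sym modulusB_ge.
Qed.

Lemma compact_closed_disc r :
  compact [set q : R * R | q.1 ^+ 2 + q.2 ^+ 2 <= r ^+ 2].
Proof.
have cb : compact (`[- `|r|, `|r|]%classic `*` `[- `|r|, `|r|]%classic : set (R * R)).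
  by apply: compact_setX; exact: segment_compact.
apply: (subclosed_compact _ cb).
  rewrite (_ : mkset _ = (fun q : R * R => q.1 ^+ 2 + q.2 ^+ 2) @^-1` [set x | x <= r ^+ 2])//.
  apply: closed_comp; last exact: closed_le.
  move=> q _; apply: cvgD; apply: cvgM; (exact: cvg_fst || exact: cvg_snd).
move=> [x y] /= xy; split; rewrite /= in_itv/= -ler_norml -ler_sqr ?nnegrE//.
  by rewrite !real_normK ?num_real// (le_trans _ xy)// lerDl sqr_ge0.
by rewrite !real_normK ?num_real// (le_trans _ xy)// lerDr sqr_ge0.
Qed.

(** |F|^2 + d |.|^2 attains its maximum on the closed disc, but not in the interior by
    [jet_not_local_max]. On the circle it is at most B^2 + d r^2 = B^2 + e, with e arbitrary. *)
Lemma maximum_modulus F r (B : R) : 0 < r ->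
  (forall p, modulus p <= r -> jet F p (F p)) ->
  (forall p, modulus p = r -> modulus (F p) <= B) ->
  modulus (F 0) <= B.
Proof.
move=> r0 Fj FB.
have B0 : 0 <= B.
  apply: le_trans (FB (r%:C)%C _); first exact: modulus_ge0.
  by rewrite modulus_real gtr0_norm.
rewrite -ler_sqr ?nnegrE ?modulus_ge0//; apply/ler_addgt0Pr => e e0.
pose d := e / r ^+ 2.
have d0 : 0 < d by rewrite divr_gt0// exprn_gt0.
pose u (q : R * R) := modulus (F (q.1 +i* q.2)%C) ^+ 2 + d * (q.1 ^+ 2 + q.2 ^+ 2).
pose A := [set q : R * R | q.1 ^+ 2 + q.2 ^+ 2 <= r ^+ 2].
have A0 : A !=set0 by exists (0, 0); rewrite /A/= !expr0n/= addr0 sqr_ge0.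
have mE (x y : R) : modulus (x +i* y)%C <= r = (x ^+ 2 + y ^+ 2 <= r ^+ 2).
  by rewrite -ler_sqr ?nnegrE ?modulus_ge0 ?(ltW r0)// sqr_modulus.
have cu : {within A, continuous u}.
  apply/subspace_continuousP => -[x y] Axy.
  apply: cvg_trans; first by apply: cvg_fmap2; exact: cvg_within.
  have c1 := jet_modulus_continuous (Fj _ (etrans (mE _ _) Axy)).
  apply: cvgD; first by apply: cvgM; exact: c1.
  apply: cvgM; first exact: cvg_cst.
  by apply: cvgD; apply: cvgM; (exact: cvg_fst || exact: cvg_snd).
have [[x y] /set_mem Axy umax] := compact_EVT_max A0 (@compact_closed_disc r) cu.
pose p := (x +i* y)%C.
have uE q : u (complex.Re q, complex.Im q) = modulus (F q) ^+ 2 + d * modulus q ^+ 2.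
  by case: q => a b; rewrite [modulus (a +i* b)%C ^+ 2]sqr_modulus.
have pmax q : modulus q <= r ->
    modulus (F q) ^+ 2 + d * modulus q ^+ 2 <= modulus (F p) ^+ 2 + d * modulus p ^+ 2.
  move=> qr; rewrite -!uE; apply: umax; rewrite inE /A /= -mE.
  by case: q qr.
have pr : modulus p <= r by rewrite mE.
have {}pr : modulus p = r.
  apply/eqP; rewrite eq_le pr/= leNgt; apply/negP => {}pr.
  apply: (jet_not_local_max d0 (Fj p (ltW pr))).
  exists (r - modulus p); rewrite ?subr_gt0// => h; rewrite ltrBrDl => hr.
  by rewrite pmax// (le_trans (modulusD _ _))// ltW.
have := pmax 0; rewrite modulus0 (ltW r0) => /(_ isT).
rewrite expr0n mulr0 addr0 => /le_trans; apply.
rewrite pr lerD//; first by rewrite ler_sqr ?nnegrE ?modulus_ge0// FB.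
by rewrite /d divfK// gt_eqF// exprn_gt0.
Qed.

End MaximumModulus.

(** * Littlewood's inequality *)

Section Moebius.
Context {R : realType}.
Implicit Types (a b p w z : R[i]).

Lemma moebius_denom_bound a w : modulus w <= 1 ->
  1 - modulus a <= modulus (1 - a^*%C * w).
Proof.
move=> w1; apply: le_trans (modulusB_ge _ _).
by rewrite modulus1 modulusM modulus_conj lerB// ler_piMr ?modulus_ge0.
Qed.

Lemma moebius_denom_neq0 a w : disc a -> disc w -> 1 - a^*%C * w != 0.
Proof.
move=> /= da dw; rewrite -modulus_gt0.
by apply: lt_le_trans (moebius_denom_bound a (ltW dw)); rewrite subr_gt0.
Qed.

Lemma moebius_identity a w :
  modulus (1 - a^*%C * w) ^+ 2 - modulus (a - w) ^+ 2 =
  (1 - modulus a ^+ 2) * (1 - modulus w ^+ 2).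
Proof.
by rewrite !sqr_modulus; case: a w => [a1 a2] [b1 b2] /=; ring.
Qed.

Lemma one_sub_sqr_moebius a w : disc a -> disc w ->
  1 - modulus (moebius a w) ^+ 2 =
  (1 - modulus a ^+ 2) * (1 - modulus w ^+ 2) / modulus (1 - a^*%C * w) ^+ 2.
Proof.
move=> da dw; rewrite -moebius_identity /moebius modulusM modulusV expr_div_n.
by field; rewrite modulus_eq0 moebius_denom_neq0.
Qed.

Lemma disc_moebius a w : disc a -> disc w -> disc (moebius a w).
Proof.
move=> da dw; rewrite /disc/= -ltr_sqr ?nnegrE ?modulus_ge0// expr1n -subr_gt0.
rewrite one_sub_sqr_moebius//; apply: divr_gt0.
  by apply: mulr_gt0; rewrite subr_gt0 exprn_ilt1 ?modulus_ge0.
by rewrite exprn_gt0// modulus_gt0 moebius_denom_neq0.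
Qed.

(** The numerators are opposite and the denominators conjugate. *)
Lemma moebius_sym a w : modulus (moebius a w) = modulus (moebius w a).
Proof.
rewrite /moebius !modulusM !modulusV modulusB_sym; congr (_ / _).
rewrite -modulus_conj; congr modulus.
by rewrite rmorphB rmorph1 rmorphM/= conjcK mulrC.
Qed.

Lemma moebius_eq0 a w : disc a -> disc w -> (moebius a w == 0) = (a == w).
Proof.
move=> da dw; rewrite mulf_eq0 invr_eq0 (negPf (moebius_denom_neq0 da dw)).
by rewrite orbF subr_eq0.
Qed.

Lemma moebius0 a : moebius a 0 = a.
Proof. by rewrite /moebius mulr0 !subr0 divr1. Qed.

Lemma one_sub_conjM_neq0 a : disc a -> 1 - a^*%C * a != 0.
Proof. by move=> da; exact: moebius_denom_neq0. Qed.

Lemma moebiusK a w : disc a -> disc w -> moebius a (moebius a w) = w.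
Proof.
move=> da dw; have d0 := moebius_denom_neq0 da dw.
have e0 := one_sub_conjM_neq0 da.
rewrite /moebius; field; rewrite d0/=.
by rewrite (_ : _ - _ = 1 - a^*%C * a)//; ring.
Qed.

Lemma moebius_jet a p : disc a -> disc p -> jet (moebius a) p (moebius a p).
Proof.
move=> da dp; apply: jetM; first exact: jetB (jet_cst a p) (jet_id p).
apply: jetV; first exact: moebius_denom_neq0.
exact: jetB (jet_cst 1 p) (jetM (jet_cst a^*%C p) (jet_id p)).
Qed.

Lemma one_sub_moebius_le a w : disc a -> disc w ->
  1 - modulus (moebius a w) <= 4 / (1 - modulus a) * (1 - modulus w).
Proof.
move=> da dw.
have m1 := ltW (disc_moebius da dw).
have aw := moebius_denom_bound a (ltW dw).
have := one_sub_sqr_moebius da dw.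
have a0 : 0 < 1 - modulus a by rewrite subr_gt0.
have w0 : 0 < 1 - modulus w by rewrite subr_gt0.
set D := modulus (1 - _) in aw *.
set M := modulus (moebius a w) in m1 *.
have M0 : 0 <= M := modulus_ge0 _.
have D0 : 0 < D := lt_le_trans a0 aw.
move: (modulus_ge0 a) (modulus_ge0 w) aw a0 w0.
set A := modulus a; set W := modulus w => A0 W0 aw a0 w0 MD.
(* As 0 <= M <= 1, 1 - M <= 1 - M^2. Then D >= 1 - A absorbs the denominator, and the constant 4
   bounds (1 + A) (1 + W). *)
have : 1 - M <= (1 - A ^+ 2) * (1 - W ^+ 2) / D ^+ 2 by rewrite -MD; nra.
move=> /le_trans; apply.
rewrite ler_pdivrMr ?exprn_gt0// mulrAC -mulrA mulrAC ler_pdivlMr//.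
have AD : (1 - A) ^+ 2 <= D ^+ 2 by rewrite ler_sqr ?nnegrE ?(ltW a0) ?(ltW D0).
have -> : (1 - A ^+ 2) * (1 - W ^+ 2) * (1 - A) =
  (1 - A) ^+ 2 * ((1 - W) * ((1 + A) * (1 + W))) by ring.
rewrite [leRHS](_ : _ = D ^+ 2 * ((1 - W) * 4)); last by ring.
have A1 : A < 1 by rewrite -subr_gt0.
have W1 : W < 1 by rewrite -subr_gt0.
apply: ler_pM => //; first exact: sqr_ge0.
  by apply: mulr_ge0; [exact: ltW|nra].
by rewrite ler_pM2l//; nra.
Qed.

End Moebius.

(** * Finite Blaschke products near the circle, and the inequality itself *)

Section Littlewood.
Context {R : realType}.
Implicit Types (phi : R[i] -> R[i]) (p w z zeta : R[i]) (s : seq R[i]).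

(** The difference quotient, expanded by [taylor_jet_shift] with m = 1, is multiplied back by w -
    p. *)
Lemma taylor_jet phi p (a : nat -> R[i]) : taylor_at phi p a -> jet phi p (phi p).
Proof.
move=> ta; have k : jet (fun w => (phi w - phi p) / (w - p) ^+ 1) p (a 1%N).
  by apply: taylor_jet_shift ta _ => // -[|[]].
have := jetD (jet_cst (phi p) p) (jetM (jetB (jet_id p) (jet_cst p p)) k).
rewrite subrr mul0r addr0; apply: (jet_eq ltr01) => h h0 _.
have -> : p + h - p = h by rewrite addrC addKr.
by rewrite expr1; field.
Qed.

Lemma multiplicity_jet phi p : analytic_at phi p ->
  exists c, jet (fun w => (phi p - phi w) / (w - p) ^+ multiplicity phi p) p c.
Proof.
move=> [b tb]; rewrite /multiplicity; case: xgetP => [m _ [m0 [a [ta _ a0]]]|_].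
  exists (- a m); apply: (jet_eq ltr01) (jetN (taylor_jet_shift m0 ta a0)).
  by move=> h _ _; rewrite -mulNr opprB.
(* No order is admissible: the multiplicity is the default 0, the denominator is 1, and the
   numerator has an expansion. *)
exists (phi p - phi p).
apply: (jet_eq ltr01) (jetB (jet_cst (phi p) p) (taylor_jet tb)) => h _ _.
by rewrite expr0 divr1.
Qed.

Lemma seq_isolated s p : exists2 r : R, 0 < r &
  forall h, h != 0 -> modulus h < r -> p + h \notin s.
Proof.
elim: s => [|x s [r r0 IH]]; first by exists 1.
have [xp|xp] := eqVneq x p.
  exists r => // h h0 hr; rewrite in_cons negb_or IH// andbT xp.
  by rewrite -subr_eq0 addrAC subrr add0r.
exists (Num.min r (modulus (x - p))).
  by rewrite lt_min r0 modulus_gt0 subr_eq0.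
move=> h h0; rewrite lt_min => /andP[hr hx].
rewrite in_cons negb_or IH// andbT; apply: contraTneq hx => <-.
by rewrite addrAC subrr add0r ltxx.
Qed.

Lemma seq_in_smaller_disc s : (forall w, w \in s -> disc w) ->
  exists2 r : R, 0 < r < 1 & forall w, w \in s -> modulus w < r.
Proof.
elim: s => [_|x s IH sd]; first by exists (2^-1) => //; lra.
have [w ws|r /andP[r0 r1] rs] := IH; first by apply: sd; rewrite in_cons ws orbT.
have x1 : modulus x < 1 by apply: sd; rewrite mem_head.
exists (Num.max r ((1 + modulus x) / 2)).
  by rewrite lt_max r0/= gt_max r1/=; lra.
move=> w; rewrite in_cons lt_max => /predU1P[->|/rs->//].
by apply/orP; right; lra.
Qed.

(** Uniform convergence to 1 at the unit circle. The bounds 0 <= f <= 1 on the disc make the notion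
    stable under products. *)
Definition tends_to_1 (f : R[i] -> R) :=
  (forall w, disc w -> 0 <= f w <= 1) /\
  forall e : R, 0 < e -> exists2 r : R, r < 1 &
    forall w, r <= modulus w < 1 -> 1 - e <= f w.

Lemma tends_to_1_cst : tends_to_1 (fun=> 1).
Proof.
split=> [w _|e e0]; first by rewrite ler01 lexx.
by exists 0 => // w _; rewrite gerBl ltW.
Qed.

Lemma tends_to_1M f g : tends_to_1 f -> tends_to_1 g ->
  tends_to_1 (fun w => f w * g w).
Proof.
move=> [f1 fl] [g1 gl]; split=> [w dw|e e0].
  have /andP[? ?] := f1 w dw; have /andP[? ?] := g1 w dw.
  by rewrite mulr_ge0//= mulr_ile1.
have e20 : 0 < e / 2 by rewrite divr_gt0.
have [r r1 fr] := fl _ e20; have [r' r'1 gr] := gl _ e20.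
exists (Num.max r r'); first by rewrite gt_max r1.
move=> w; rewrite ge_max -andbA => /and3P[rw r'w dw].
have := fr w; rewrite rw dw => /(_ isT).
have := gr w; rewrite r'w dw => /(_ isT).
have /andP[? ?] := f1 w dw; have /andP[? ?] := g1 w dw; nra.
Qed.

Lemma tends_to_1_eq f g : f =1 g -> tends_to_1 f -> tends_to_1 g.
Proof. by move=> /funext ->. Qed.

Lemma tends_to_1X f n : tends_to_1 f -> tends_to_1 (fun w => f w ^+ n).
Proof.
move=> fl; elim: n => [|n IH]; first exact: tends_to_1_cst.
by apply: tends_to_1_eq (tends_to_1M fl IH) => w; rewrite exprS.
Qed.

Lemma tends_to_1_prod s (F : R[i] -> R[i] -> R) :
  (forall i, i \in s -> tends_to_1 (F i)) ->
  tends_to_1 (fun w => \prod_(i <- s) F i w).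
Proof.
elim: s => [_|x s IH Fl].
  by apply: tends_to_1_eq tends_to_1_cst => w; rewrite big_nil.
have Fx : tends_to_1 (F x) by apply: Fl; rewrite mem_head.
have Fs : tends_to_1 (fun w => \prod_(i <- s) F i w).
  by apply: IH => i si; apply: Fl; rewrite in_cons si orbT.
by apply: tends_to_1_eq (tends_to_1M Fx Fs) => w; rewrite big_cons.
Qed.

Lemma tends_to_1_moebius a : disc a -> tends_to_1 (fun w => modulus (moebius a w)).
Proof.
move=> da; split=> [w dw|e e0].
  by rewrite modulus_ge0 ltW// disc_moebius.
have a0 : 0 < 1 - modulus a by rewrite subr_gt0.
pose K := 4 / (1 - modulus a).
have K0 : 0 < K by rewrite divr_gt0.
exists (1 - e / K); first by rewrite gtrBl divr_gt0.
move=> w /andP[rw dw]; have := one_sub_moebius_le da dw.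
have : K * (1 - modulus w) <= e by rewrite mulrC -ler_pdivlMr// lerBlDl -lerBlDr.
by rewrite -/K; lra.
Qed.

Lemma littlewood phi z s : analytic_self_map phi -> disc z -> z != phi 0 ->
  uniq s -> (forall zeta, zeta \in s -> disc zeta /\ phi zeta = z) ->
  modulus (moebius z (phi 0)) <=
  \prod_(zeta <- s) modulus zeta ^+ multiplicity phi zeta.
Proof.
move=> phiA dz zphi0 us sP.
pose m := multiplicity phi.
pose G w := moebius z (phi w).
pose fac zeta w := moebius zeta w ^+ m zeta.
pose B w := \prod_(zeta <- s) fac zeta w.
pose Q w := G w / B w.
have phij p : disc p -> jet phi p (phi p).
  by move=> /phiA[_ [a]]; exact: taylor_jet.
have denj p : disc p -> jet (fun w => (1 - z^*%C * phi w)^-1) p (1 - z^*%C * phi p)^-1.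
  move=> dp; apply: jetV; first exact: moebius_denom_neq0 dz (phiA p dp).1.
  exact: jetB (jet_cst 1 p) (jetM (jet_cst _ p) (phij p dp)).
have facj zeta p : disc zeta -> disc p -> jet (fac zeta) p (fac zeta p).
  by move=> dzeta dp; apply: jetX; exact: moebius_jet.
have fac_neq0 zeta p : disc zeta -> disc p -> zeta != p -> fac zeta p != 0.
  by move=> dzeta dp zp; rewrite expf_neq0// moebius_eq0.
have prodj t p : {subset t <= s} -> disc p ->
    jet (fun w => \prod_(zeta <- t) fac zeta w) p (\prod_(zeta <- t) fac zeta p).
  move=> ts dp; elim: t ts => [|x t IH] ts.
    by rewrite big_nil; apply: (jet_eq ltr01) (jet_cst 1 p) => h _ _; rewrite big_nil.
  have dx : disc x by have [] := sP x (ts x (mem_head _ _)).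
  have {}IH := IH (fun y yt => ts y (mem_behead (s := x :: t) yt)).
  rewrite big_cons; apply: (jet_eq ltr01) (jetM (facj x p dx dp) IH) => h _ _.
  by rewrite big_cons.
have prod_neq0 t p : {subset t <= s} -> disc p -> p \notin t ->
    \prod_(zeta <- t) fac zeta p != 0.
  move=> ts dp pt; rewrite prodf_seq_neq0; apply/allP => x xt /=.
  apply: fac_neq0 => //; first by have [] := sP x (ts x xt).
  by apply: contraNneq pt => <-.
have Qj p : disc p -> p \notin s -> jet Q p (Q p).
  move=> dp ps; apply: jetM.
    by apply: jetM (denj p dp); exact: jetB (jet_cst z p) (phij p dp).
  by apply: jetV; [exact: prod_neq0|exact: prodj].
(* At a preimage [p] the factor of [B] at [p] is (w - p)^m up to a nonvanishing factor, and
   [multiplicity_jet] divides it out of [G]; the other factors do not vanish at [p]. *)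
have Qj' p : p \in s -> exists c, jet Q p c.
  move=> ps; have [dp phip] := sP p ps.
  have [c cj] := multiplicity_jet (phiA p dp).2.
  pose t := rem p s.
  have ts : {subset t <= s} by exact: mem_rem.
  have pt : p \notin t by rewrite mem_rem_uniq// inE eqxx.
  have lj := jetX (m p) (jetB (jet_cst 0 p)
    (jetB (jet_cst 1 p) (jetM (jet_cst p^*%C p) (jet_id p)))).
  have tj := jetV (prod_neq0 t p ts dp pt) (prodj t p ts dp).
  have jj := jetM (jetM (jetM cj (denj p dp)) lj) tj.
  have rp : 0 < 1 - modulus p by rewrite subr_gt0; exact: dp.
  eexists; apply: (jet_eq rp _ jj) => h h0 hr.
  have dph : disc (p + h).
    by rewrite /disc/= (le_lt_trans (modulusD _ _))// -ltrBrDl.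
  rewrite [Q _]/Q /B (big_rem p ps)/= -/t invfM mulrA; congr (_ / _).
  rewrite /G /fac /moebius phip -/(m p).
  have -> : p + h - p = h by rewrite addrC addKr.
  have -> : p - (p + h) = - h by rewrite opprD addNKr.
  have E0 := moebius_denom_neq0 dp dph; move: E0; set E := 1 - _ => E0.
  rewrite (_ : - h / E = h / (0 - E)); last by field.
  rewrite expr_div_n invf_div.
  have h1 : h ^+ m p != 0 by rewrite expf_neq0.
  by field; rewrite h1 moebius_denom_neq0//; exact: (phiA _ dph).1.
(* [F] fills the removable singularities: on [s] the value of [Q] is replaced by the constant term
   of an expansion. *)
pose F w := if w \in s then xget 0 [set c | jet Q w c] else Q w.
have Fj p : disc p -> jet F p (F p).
  move=> dp; have [r r0 rs] := seq_isolated s p.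
  apply: (@jet_eq _ Q F _ _ r r0).
    by move=> h h0 hr; rewrite /F (negPf (rs h h0 hr)).
  rewrite /F; case: ifPn => [ps|]; last exact: Qj.
  by case: xgetP => [c _ //|abs]; have [c /abs] := Qj' p ps.
have [r1 /andP[r10 r11] sr1] := seq_in_smaller_disc (fun w ws => (sP w ws).1).
have [_ Bl] : tends_to_1 (fun w => \prod_(zeta <- s) modulus (moebius zeta w) ^+ m zeta).
  apply: tends_to_1_prod => x /sP[dx _].
  by apply: tends_to_1X; exact: tends_to_1_moebius.
have G1 w : disc w -> modulus (G w) <= 1.
  by move=> dw; rewrite ltW// disc_moebius//; exact: (phiA w dw).1.
have d0 : disc (0 : R[i]) by rewrite /disc /mkset modulus0.
have s0 : 0 \notin s by apply: contra zphi0 => /sP[_ ->].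
set P := \prod_(_ <- _) _.
have B0 : modulus (B 0) = P.
  by rewrite modulus_prod; apply: eq_bigr => x _; rewrite modulusX moebius0.
have P0 : 0 < P by rewrite -B0 modulus_gt0 prod_neq0.
apply/ler_addgt0Pr => e e0.
(* The cap at 1/2 keeps 1 - e' positive. *)
pose e' := Num.min e 2^-1.
have e'0 : 0 < e' by rewrite lt_min e0/= invr_gt0.
have e'1 : e' < 1 by rewrite gt_min; apply/orP; right; lra.
have [r2 r21 Br2] := Bl e' e'0.
(* The circle of radius [r] surrounds all points of [s], and |B| >= 1 - e' on it, so |Q| <= 1 / (1 -
   e') there. *)
pose r := Num.max r1 r2.
have r0 : 0 < r by rewrite lt_max r10.
have r_lt1 : r < 1 by rewrite gt_max r11.
have : modulus (F 0) <= (1 - e')^-1.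
  apply: (maximum_modulus r0) => p pr.
    by apply: Fj; exact: le_lt_trans pr r_lt1.
  have dp : disc p by rewrite /disc/= pr.
  have ps : p \notin s.
    by apply/negP => /sr1; rewrite pr ltNge le_max lexx.
  rewrite /F (negPf ps) /Q modulusM modulusV -[leRHS]mul1r.
  have BE : 1 - e' <= modulus (B p).
    rewrite modulus_prod (le_trans (Br2 p _))// ?pr ?r_lt1 ?le_max ?lexx ?orbT//.
    by rewrite le_eqVlt; apply/orP; left; apply/eqP/eq_bigr => x _; rewrite modulusX.
  have e1 : 0 < 1 - e' by rewrite subr_gt0.
  rewrite ler_pM ?modulus_ge0 ?invr_ge0 ?modulus_ge0 ?G1//.
  by rewrite lef_pV2// posrE// (lt_le_trans e1).
rewrite /F (negPf s0) /Q modulusM modulusV B0 ler_pdivrMr// mulrC.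
rewrite ler_pdivlMr ?subr_gt0// => H.
(* |G 0| (1 - e') <= P and |G 0| <= 1 give |G 0| <= P + e'. *)
have := G1 0 d0; have : e' <= e by rewrite ge_min lexx.
move: H; rewrite -/(G 0); have := modulus_ge0 (G 0); nra.
Qed.

End Littlewood.

(** * Radial weights *)

Section Weights.
Context {R : realType}.
Implicit Types (omega : R[i] -> R) (z w : R[i]) (r s : R).
Local Notation mu := (@lebesgue_measure R).

Lemma measurable_disc :
  measurable [set p : R * R | disc (p.1 +i* p.2)%C].
Proof.
rewrite (_ : mkset _ = setT `&` (fun p : R * R => p.1 ^+ 2 + p.2 ^+ 2) @^-1` [set` `]-oo, 1[]).
  by apply: measurable_funD => //; apply: measurable_funX.
apply/seteqP; split=> -[x y]; rewrite /disc/= in_itv/=.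
  move=> xy; split=> //; have := sqr_modulus (x +i* y)%C => /= <-.
  by rewrite exprn_ilt1 ?modulus_ge0.
move=> [_] xy; rewrite -ltr_sqr ?nnegrE ?modulus_ge0// expr1n.
by have := sqr_modulus (x +i* y)%C => /= ->.
Qed.

Lemma disc_itv r s : 0 <= r -> s \in `[r, 1[ -> disc (s%:C : R[i])%C.
Proof.
rewrite in_itv/= => r0 /andP[rs s1].
by rewrite /disc /mkset modulus_real ger0_norm// (le_trans r0).
Qed.

Lemma weight_itv_ge0 omega r s : weight omega -> 0 <= r -> s \in `[r, 1[ ->
  0 <= omega (s%:C)%C.
Proof. by move=> [om0 _] r0 /(disc_itv r0); exact: om0. Qed.

(** Measurability on the disc pulls back along s |-> (s, 0). *)
Lemma measurable_weight_itv omega r : weight omega -> 0 <= r ->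
  measurable_fun [set` `[r, 1[] (fun s => omega (s%:C)%C).
Proof.
move=> [_ /measurable_int/measurable_EFinP mo] r0.
apply: (@measurable_comp _ _ _ _ _ _ _ (fun p : R * R => omega (p.1 +i* p.2)%C) _
  (fun s : R => (s, 0))) mo _ => //.
- exact: measurable_disc.
- by move=> _ [s rs <-] /=; exact: disc_itv rs.
- by apply: measurable_funTS; exact: measurable_fun_pair.
Qed.

Lemma measurable_star omega r r' : weight omega -> 0 <= r ->
  measurable_fun [set` `[r, 1[] (fun s => omega (s%:C)%C * ln (s / r') * s).
Proof.
move=> ow r0; apply: measurable_funM => //.
apply: measurable_funM; first exact: measurable_weight_itv.
by apply: measurable_funTS; apply: measurableT_comp => //; exact: measurable_funM.
Qed.

Lemma hat_ge0 omega r : weight omega -> 0 <= r -> (0 <= hat omega r)%E.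
Proof.
move=> ow r0; apply: integral_ge0 => s rs.
by rewrite lee_fin (weight_itv_ge0 ow r0).
Qed.

Lemma le_hat omega r r' : weight omega -> 0 <= r -> r <= r' ->
  (hat omega r' <= hat omega r)%E.
Proof.
move=> ow r0 rr'; apply: ge0_subset_integral => //.
- by apply/measurable_EFinP; exact: measurable_weight_itv.
- by move=> s rs; rewrite lee_fin (weight_itv_ge0 ow r0).
- by move=> s /=; rewrite !in_itv/= => /andP[/(le_trans rr')-> ->].
Qed.

Lemma star_integrand_ge0 omega r r' s : weight omega -> 0 < r' -> r' <= r ->
  s \in `[r, 1[ -> 0 <= omega (s%:C)%C * ln (s / r') * s.
Proof.
move=> ow r0 rr' sr; have r0' : 0 <= r by rewrite (le_trans (ltW r0)).
have := sr; rewrite in_itv/= => /andP[rs _].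
rewrite !mulr_ge0 ?(weight_itv_ge0 ow _ sr)//.
  by rewrite ln_ge0// ler_pdivlMr// mul1r (le_trans rr').
exact: le_trans rs.
Qed.

Lemma star_ge0 omega z : weight omega -> z != 0 -> (0 <= star omega z)%E.
Proof.
move=> ow; rewrite -modulus_gt0 => z0; apply: integral_ge0 => s rs.
by rewrite lee_fin; apply: star_integrand_ge0 rs.
Qed.

(** With r = |z|, ln (s / r) <= ln (1 / r) and s <= 1 on the range of integration. *)
Lemma star_le_hat omega z : weight omega -> disc z -> z != 0 ->
  (star omega z <= (ln (modulus z)^-1)%:E * hat omega (modulus z))%E.
Proof.
move=> ow z1; rewrite -modulus_gt0 => z0.
rewrite /star /hat; set r := modulus z in z0 *.
have mo := measurable_weight_itv ow (ltW z0).
have r1 : 1 <= r^-1 by rewrite invf_ge1// ltW.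
rewrite -ge0_integralZl//; last 3 first.
- exact/measurable_EFinP.
- by move=> s rs; rewrite lee_fin (weight_itv_ge0 ow (ltW z0)).
- by rewrite lee_fin ln_ge0.
apply: ge0_le_integral => //.
- by move=> s rs; rewrite lee_fin; apply: star_integrand_ge0 rs.
- by apply/measurable_EFinP; apply: measurable_star => //; exact: ltW.
- by apply/measurable_EFinP; exact: measurable_funM.
move=> s rs; rewrite lee_fin.
have om0 := weight_itv_ge0 ow (ltW z0) rs.
move: rs => /=; rewrite in_itv/= => /andP[rs s1].
have s0 : 0 < s by exact: lt_le_trans rs.
have ls0 : 0 <= ln (s / r) by rewrite ln_ge0// ler_pdivlMr// mul1r.
have ls : ln (s / r) <= ln r^-1.
  by rewrite ler_ln ?posrE ?divr_gt0 ?invr_gt0// ler_piMl ?invr_ge0 ?(ltW z0) ?(ltW s1).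
rewrite -[leRHS]/(ln r^-1 * _) -mulrA [leRHS]mulrC ler_wpM2l// (le_trans _ ls)//.
by rewrite ler_piMr// ltW.
Qed.

(** With r = |z|, only s >= (1 + r) / 2 is kept. There ln (s / r) >= 1 - r / s >= (1 - r) / 2 and s
    >= 1/2, whence the factor 1/4. *)
Lemma hat_le_star omega z : weight omega -> disc z -> z != 0 ->
  (((1 - modulus z) / 4)%:E * hat omega ((1 + modulus z) / 2) <= star omega z)%E.
Proof.
move=> ow z1; rewrite -modulus_gt0 => z0; rewrite /disc/= in z1.
rewrite /star /hat; set r := modulus z in z0 z1 *.
have r2 : r <= (1 + r) / 2 by lra.
have r20 : 0 <= (1 + r) / 2 by lra.
have mo := measurable_weight_itv ow r20.
rewrite -ge0_integralZl//; last 3 first.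
- exact/measurable_EFinP.
- by move=> s rs; rewrite lee_fin (weight_itv_ge0 ow r20).
- by rewrite lee_fin; lra.
apply: (@le_trans _ _ (\int[mu]_(s in `[((1 + r) / 2)%R, 1%R[)
     (omega s%:C%C * ln (s / r) * s)%:E)%E); last first.
  apply: ge0_subset_integral => //.
  - by apply/measurable_EFinP; apply: measurable_star => //; exact: ltW.
  - by move=> s rs; rewrite lee_fin; apply: star_integrand_ge0 rs.
  - by move=> s /=; rewrite !in_itv/= => /andP[/(le_trans r2)-> ->].
apply: ge0_le_integral => //.
- move=> s rs; rewrite lee_fin mulr_ge0//; first by lra.
  exact: weight_itv_ge0 rs.
- by apply/measurable_EFinP; exact: measurable_funM.
- by apply/measurable_EFinP; exact: measurable_star.
move=> s rs; rewrite lee_fin.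
have om0 := weight_itv_ge0 ow r20 rs.
move: rs => /=; rewrite in_itv/= => /andP[rs s1].
have s2 : 2^-1 <= s by lra.
have s0 : 0 < s by lra.
have : (1 - r) / 2 <= ln (s / r).
  rewrite -[s / r]invf_div lnV ?posrE ?divr_gt0// lerNr.
  rewrite (_ : r / s = 1 + (r / s - 1)); last by ring.
  have rs2 : r / s <= 1 - (1 - r) / 2 by rewrite ler_pdivrMr//; nra.
  by rewrite (le_trans (le_ln1Dx _))//; have := divr_gt0 z0 s0; lra.
move: (ln _) (omega _) om0 => l o om0 rl.
rewrite -[leLHS]/(_ / 4 * o) mulrC -mulrA ler_wpM2l//; nra.
Qed.

(** A larger modulus shrinks both the logarithm and the range of integration. *)
Lemma le_star omega z w : weight omega -> z != 0 -> modulus z <= modulus w ->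
  (star omega w <= star omega z)%E.
Proof.
move=> ow; rewrite -modulus_gt0 => z0 zw.
have w0 : 0 < modulus w := lt_le_trans z0 zw.
rewrite /star; move: (modulus z) (modulus w) z0 w0 zw => r r' r0 r'0 rr'.
apply: (@le_trans _ _ (\int[mu]_(s in `[r', 1%R[) (omega s%:C%C * ln (s / r) * s)%:E)%E).
  apply: ge0_le_integral => //.
  - by move=> s rs; rewrite lee_fin; apply: star_integrand_ge0 rs.
  - by apply/measurable_EFinP; apply: measurable_star => //; exact: ltW.
  - by apply/measurable_EFinP; apply: measurable_star => //; exact: ltW.
  move=> s rs; rewrite lee_fin.
  have om0 := weight_itv_ge0 ow (ltW r'0) rs.
  move: rs => /=; rewrite in_itv/= => /andP[rs s1].
  have s0 : 0 < s := lt_le_trans r'0 rs.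
  rewrite ler_wpM2r ?(ltW s0)// ler_wpM2l// ler_ln ?posrE ?divr_gt0//.
  by rewrite ler_wpM2l ?(ltW s0)// lef_pV2.
apply: ge0_subset_integral => //.
- by apply/measurable_EFinP; apply: measurable_star => //; exact: ltW.
- by move=> s rs; rewrite lee_fin; apply: star_integrand_ge0 rs.
- by move=> s /=; rewrite !in_itv/= => /andP[/(le_trans rr')-> ->].
Qed.

End Weights.

(** * The equivalence *)

Section MoebiusTaylor.
Context {R : realType}.
Implicit Types (a p h w z : R[i]).

(* With d = 1 - conj a * p, one has
   moebius a (p + h) = moebius a p - (1 - |a|^2) h / (d (d - conj a * h)). *)
Definition moebius_coef a p (n : nat) : R[i] :=
  let d := 1 - a^*%C * p in
  if n is n'.+1 then - (1 - a^*%C * a) / d ^+ 2 * (a^*%C / d) ^+ n' else moebius a p.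

Lemma moebius_partial_sum a p h n :
  1 - a^*%C * p != 0 -> 1 - a^*%C * (p + h) != 0 ->
  \sum_(0 <= i < n.+1) moebius_coef a p i * h ^+ i - moebius a (p + h) =
  (1 - a^*%C * a) * h / ((1 - a^*%C * p) * (1 - a^*%C * (p + h))) *
  (a^*%C / (1 - a^*%C * p) * h) ^+ n.
Proof.
move=> d0 e0; elim: n => [|n IH].
  by rewrite big_nat1 /moebius !expr0 /moebius_coef /moebius; field; apply/andP.
by rewrite big_nat_recr//= addrAC IH !exprMn !exprS; field; apply/andP.
Qed.

Lemma taylor_moebius a p : disc a -> disc p ->
  taylor_at (moebius a) p (moebius_coef a p).
Proof.
move=> da dp; have d0 := moebius_denom_neq0 da dp.
set d := 1 - a^*%C * p in d0 *.
(* Within distance |d| the ratio [q] has modulus below 1, because |a| < 1. *)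
apply/nbhs_modulus; exists (modulus d); first by rewrite modulus_gt0.
move=> w wd; set h := w - p in wd *.
have {1}-> : w = p + h by rewrite /h subrKC.
pose q := a^*%C / d * h.
have q1 : modulus q < 1.
  rewrite /q !modulusM modulusV modulus_conj mulrAC ltr_pdivrMr ?modulus_gt0//.
  by rewrite mul1r (le_lt_trans _ wd)// ler_piMl ?modulus_ge0// ltW.
(* This denominator equals d (1 - q). *)
have e0 : 1 - a^*%C * (p + h) != 0.
  have : 1 - q != 0.
    by apply: contraTneq q1 => /subr0_eq <-; rewrite modulus1 ltxx.
  apply: contraNneq => e0; have -> : 1 - q = (1 - a^*%C * (p + h)) / d.
    by rewrite /q /d; field; rewrite d0.
  by rewrite e0 mul0r.
pose c := (1 - a^*%C * a) * h / (d * (1 - a^*%C * (p + h))).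
apply/cvg_modulus => e ep.
have cq : (geometric (modulus c) (modulus q)) @ \oo --> (0 : R).
  by apply: cvg_geometric; rewrite ger0_norm ?modulus_ge0.
have /cvgrPdist_lt/(_ _ ep)[N _ hN] := cq.
exists N.+1 => // -[//|n] /= Nn; rewrite seriesEnat/= moebius_partial_sum//.
have := hN n Nn; rewrite sub0r normrN /geometric/= ger0_norm.
  by rewrite -modulusX -modulusM.
by rewrite mulr_ge0 ?exprn_ge0 ?modulus_ge0.
Qed.

Lemma moebius_self_map a : disc a -> analytic_self_map (moebius a).
Proof.
move=> da z dz; split; first exact: disc_moebius.
by exists (moebius_coef a z); exact: taylor_moebius.
Qed.

(** Order 1 is admissible, since the linear coefficient -(1 - |a|^2) / d^2 is not 0; so the default
    0 is not taken. *)
Lemma moebius_multiplicity_gt0 a p : disc a -> disc p ->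
  (0 < multiplicity (moebius a) p)%N.
Proof.
move=> da dp; rewrite /multiplicity; case: xgetP => [m _ []//|/(_ 1%N)[]].
split=> //; exists (moebius_coef a p); split; first exact: taylor_moebius.
  rewrite /= expr0 mulr1 mulf_neq0 ?oppr_eq0 ?one_sub_conjM_neq0//.
  by rewrite invr_eq0 expf_neq0// moebius_denom_neq0.
by move=> [|[]].
Qed.

End MoebiusTaylor.

(** * Counting function estimates and the two main implications *)

Section Main.
Context {R : realType}.
Implicit Types (a z w : R[i]) (phi : R[i] -> R[i]) (omega : R[i] -> R) (r t : R).

(** Bernoulli's inequality and the Archimedean property. *)
Lemma expr_unbounded (al x : R) : 0 < al -> exists n, x <= (1 + al) ^+ n.
Proof.
move=> al0; have bern n : 1 + n%:R * al <= (1 + al) ^+ n.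
  elim: n => [|n IH]; first by rewrite mul0r addr0 expr0.
  rewrite exprS -natr1; have := ler0n R n.
  have : (1 + al) * (1 + n%:R * al) <= (1 + al) * (1 + al) ^+ n.
    by rewrite ler_wpM2l// addr_ge0// ltW.
  nra.
exists (Num.bound (`|x| / al)); apply: le_trans (bern _).
have : `|x| / al < (Num.bound (`|x| / al))%:R.
  by apply: archi_boundP; rewrite divr_ge0// ltW.
rewrite ltr_pdivrMr// => /ltW xb; rewrite (le_trans (ler_norm x))// (le_trans xb)//.
by rewrite lerDr.
Qed.

(** In the variable t = 1 - r each use of the doubling condition halves [t]. *)
Lemma Dhat_iter omega (C : R) n t : 0 <= C ->
  (forall r, 0 <= r < 1 -> (hat omega r <= C%:E * hat omega ((1 + r) / 2))%E) ->
  0 < t <= 1 -> (hat omega (1 - t) <= (C ^+ n)%:E * hat omega (1 - t / 2 ^+ n))%E.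
Proof.
move=> C0 oC; elim: n t => [|n IH] t /andP[t0 t1].
  by rewrite expr0 mul1e expr0 divr1.
apply: le_trans (oC _ _) _; first by lra.
rewrite exprS EFinM -muleA lee_wpmul2l ?lee_fin//.
have -> : (1 + (1 - t)) / 2 = 1 - t / 2 by lra.
have -> : t / 2 ^+ n.+1 = t / 2 / 2 ^+ n by rewrite exprS invfM mulrA.
by apply: IH; lra.
Qed.

(** ln (1 / r) <= 1 / r - 1 = (1 - r) / r. *)
Lemma ln_inv_le r : 2^-1 <= r -> r <= 1 -> ln r^-1 <= 2 * (1 - r).
Proof.
move=> r2 r1; have r0 : 0 < r by lra.
have r1' : r * r^-1 = 1 by rewrite mulfV// gt_eqF.
have ri0 : 0 < r^-1 by rewrite invr_gt0.
rewrite (_ : r^-1 = 1 + (r^-1 - 1)); last by ring.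
apply: (@le_trans _ _ (r^-1 - 1)); last by nra.
by apply: le_ln1Dx; lra.
Qed.

(** Links Littlewood's product to the sum in the counting function. Positivity is part of the
    induction, as the logarithm splits over positive factors. *)
Lemma sum_ln_inv (s : seq R[i]) (m : R[i] -> nat) : (forall w, w \in s -> w != 0) ->
  0 < \prod_(w <- s) modulus w ^+ m w /\
  \sum_(w <- s) (m w)%:R * ln (modulus w)^-1 =
  ln (\prod_(w <- s) modulus w ^+ m w)^-1.
Proof.
elim: s => [_|x s IH s0]; first by rewrite !big_nil invr1 ln1.
have [w ws|p0 IHs] := IH; first by apply: s0; rewrite in_cons ws orbT.
have x0 : 0 < modulus x by rewrite modulus_gt0 s0// mem_head.
rewrite !big_cons mulr_gt0 ?exprn_gt0//; split=> //.
rewrite invfM lnM ?posrE ?invr_gt0 ?exprn_gt0// IHs; congr (_ + _).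
by rewrite -exprVn lnXn ?invr_gt0// mulr_natl.
Qed.

Lemma fine_hat omega r : hat_nondegenerate omega -> 0 <= r < 1 ->
  hat omega r = (fine (hat omega r))%:E /\ 0 < fine (hat omega r).
Proof.
move=> /(_ r) + r01 => /(_ r01)/andP[h0 hoo].
have hf : hat omega r \is a fin_num by rewrite ge0_fin_numE// ltW.
by rewrite fineK//; split=> //; apply: fine_gt0; rewrite h0.
Qed.

(** The counting function is a supremum over finite sets of preimages. On each one, [star_le_hat]
    and |w| >= rho reduce the sum to hat omega rho times the logarithm of the inverse of
    Littlewood's product. *)
Lemma nevanlinna_le_hat phi omega z : analytic_self_map phi -> weight omega ->
  hat_nondegenerate omega -> disc z -> z != phi 0 ->
  (nevanlinna_counting phi (star omega) z <=
   (ln (modulus (moebius z (phi 0%R)))^-1)%:E *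
   hat omega (modulus (moebius z (phi 0%R))))%E.
Proof.
move=> phiA ow nd dz zphi0; set rho := modulus _.
have d0 : disc (0 : R[i]) by rewrite /disc /mkset modulus0.
have db : disc (phi 0) := (phiA 0 d0).1.
have rho0 : 0 < rho by rewrite modulus_gt0 moebius_eq0.
have rho1 : rho < 1 by exact: disc_moebius.
have [HE H0] : hat omega rho = (fine (hat omega rho))%:E /\ 0 < fine (hat omega rho).
  by apply: fine_hat; rewrite // ltW.
set H := fine _ in HE H0; rewrite HE.
apply: ge_ereal_sup => _ [X [Xfin XP] <-].
rewrite fsbig_finite//=; set s : seq R[i] := finmap.enum_fset (fset_set X).
have sP w : w \in s -> disc w /\ phi w = z.
  move=> ws; apply: XP; apply/set_mem.
  by rewrite -(in_fset_set Xfin w).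
have s0 w : w \in s -> w != 0.
  by move=> /sP[_ pw]; apply: contraNneq zphi0 => w0; rewrite -pw w0.
have [P0 lnP] := sum_ln_inv (multiplicity phi) s0.
have rhoP := littlewood phiA dz zphi0 (finmap.fset_uniq _) sP.
apply: (@le_trans _ _ (\sum_(w <- s) ((multiplicity phi w)%:R * ln (modulus w)^-1 * H)%:E)%E).
  rewrite big_seq [leRHS]big_seq; apply: lee_sum => w ws.
  have [dw pw] := sP w ws; have w0 := s0 w ws.
  rewrite -mulrA EFinM.
  have [->|m0] := posnP (multiplicity phi w); first by rewrite !mul0e.
  apply: lee_wpmul2l; first by rewrite lee_fin.
  apply: le_trans (star_le_hat ow dw w0) _.
  rewrite EFinM -HE; apply: lee_wpmul2l.
    by rewrite lee_fin ln_ge0// invf_ge1 ?modulus_gt0// ltW.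
  apply: le_hat => //; first exact: ltW.
  (* Littlewood's inequality for the single preimage [w] gives rho <= |w|^m <= |w|, as m >= 1. *)
  have := @littlewood _ phi z [:: w] phiA dz zphi0 isT.
  rewrite big_seq1; move/(_ _)/le_trans; apply; last first.
    by rewrite -[leRHS]expr1 ler_wiXn2l ?modulus_ge0// ltW.
  by move=> x; rewrite inE => /eqP ->.
rewrite sumEFin lee_fin -mulr_suml lnP -lee_fin.
rewrite lee_fin ler_wpM2r ?(ltW H0)// ler_ln ?posrE ?invr_gt0//.
by rewrite lef_pV2.
Qed.

(* Chosen so that 1 - |moebius (phi 0) z| <= 4 / (1 - |phi 0|) * (1 - |z|) is
   at most 1/2 for |z| >= radius phi. *)
Definition radius phi : R := 1 - (1 - modulus (phi 0)) / 8.

Lemma radius_itv phi : analytic_self_map phi -> 0 < radius phi < 1.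
Proof.
move=> phiA; have d0 : disc (0 : R[i]) by rewrite /disc /mkset modulus0.
have := (phiA 0 d0).1; rewrite /disc/= /radius; have := modulus_ge0 (phi 0).
by move: (modulus _) => b; lra.
Qed.

Lemma Dhat_counting_bound phi omega : analytic_self_map phi ->
  hat_nondegenerate omega -> Dhat omega ->
  exists2 M : R, 0 < M & counting_bound phi omega M (radius phi).
Proof.
move=> phiA nd [[ow _] [C C0 oC]].
have d0 : disc (0 : R[i]) by rewrite /disc /mkset modulus0.
have db : disc (phi 0) := (phiA 0 d0).1.
have b1 : 0 < 1 - modulus (phi 0) by rewrite subr_gt0.
pose K := 4 / (1 - modulus (phi 0)).
have K0 : 0 < K by rewrite divr_gt0.
have KE : K * (1 - modulus (phi 0)) = 4 by rewrite /K divfK// gt_eqF.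
(* With t = 1 - |z|, n halvings bring K t down to at most t / 2 = 1 - (1 + |z|) / 2. *)
have [n nK] := expr_unbounded (2 * K) (@ltr01 R).
have {}nK : 2 * K <= 2 ^+ n by rewrite (le_trans nK).
have n0 : 0 < (2 ^+ n : R) by rewrite exprn_gt0.
have Cn0 : 0 < C ^+ n by rewrite exprn_gt0.
(* 2 K comes from the logarithm, C^n from the halvings, and the remaining 4 from the t / 4 of
   [hat_le_star]. *)
exists (8 * K * C ^+ n); first by rewrite mulr_gt0// mulr_gt0.
move=> z dz zphi0; rewrite /radius => rz.
have := nevanlinna_le_hat phiA ow nd dz zphi0.
set rho := modulus (moebius _ _) => /= Nle.
have rho1 : rho < 1 by exact: disc_moebius.
have rhoK : 1 - rho <= K * (1 - modulus z).
  by rewrite /rho moebius_sym; exact: one_sub_moebius_le.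
pose t := 1 - modulus z.
have t0 : 0 < t by rewrite subr_gt0; exact: dz.
have Kt : K * t <= 2^-1.
  have : K * t <= K * ((1 - modulus (phi 0)) / 8).
    by rewrite ler_pM2l// /t; lra.
  by rewrite mulrA KE; lra.
have rho2 : 2^-1 <= rho by rewrite -/t in rhoK; lra.
have z0 : z != 0.
  rewrite -modulus_gt0; apply: lt_le_trans rz; have := modulus_ge0 (phi 0); lra.
apply: le_trans Nle _.
apply: (@le_trans _ _ ((2 * K * t)%:E * ((C ^+ n)%:E * hat omega ((1 + modulus z) / 2)))%E).
  apply: lee_pmul.
  - by rewrite lee_fin ln_ge0// invf_ge1; lra.
  - by apply: hat_ge0 => //; exact: modulus_ge0.
  - rewrite lee_fin (le_trans (ln_inv_le rho2 (ltW rho1)))// -mulrA ler_pM2l//.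
  apply: (@le_trans _ _ (hat omega (1 - K * t))).
    by apply: le_hat => //; rewrite -/t in rhoK; lra.
  have Kt01 : 0 < K * t <= 1 by rewrite mulr_gt0//=; lra.
  apply: le_trans (Dhat_iter n (ltW C0) oC Kt01) _.
  apply: lee_wpmul2l; first by rewrite lee_fin exprn_ge0// ltW.
  have Ktn : K * t / 2 ^+ n <= t / 2 by rewrite ler_pdivrMr//; nra.
  apply: le_hat => //; first by rewrite divr_ge0// addr_ge0 ?modulus_ge0.
  by move: Ktn; rewrite /t; lra.
have := hat_le_star ow dz z0; rewrite -/t => hs.
apply: (@le_trans _ _
  ((8 * K * C ^+ n)%:E * ((t / 4)%:E * hat omega ((1 + modulus z) / 2)))%E).
  rewrite !muleA -!EFinM le_eqVlt; apply/orP; left; apply/eqP.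
  by congr (_%:E * _)%E; field.
by apply: lee_wpmul2l hs; rewrite lee_fin mulr_ge0 ?(ltW Cn0)// mulr_ge0 ?(ltW K0).
Qed.

Lemma star_modulus omega z w : modulus z = modulus w -> star omega z = star omega w.
Proof. by rewrite /star => ->. Qed.

(** [moebius a] is an involution of the disc, so [moebius a z] is the only preimage of [z]; its
    multiplicity is at least 1. *)
Lemma star_le_nevanlinna a omega z : disc a -> weight omega -> disc z -> z != a ->
  (star omega (moebius a z) <= nevanlinna_counting (moebius a) (star omega) z)%E.
Proof.
move=> da ow dz za; have dm := disc_moebius da dz.
have m0 : moebius a z != 0 by rewrite moebius_eq0// eq_sym.
have s0 := star_ge0 ow m0.
have mu1 := moebius_multiplicity_gt0 da dm.
rewrite /nevanlinna_counting (_ : mkset _ = [set moebius a z]); last first.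
  apply/seteqP; split=> [w [dw <-]|_ ->] /=; first by rewrite moebiusK.
  by rewrite moebiusK.
rewrite esum_set1; last by rewrite mule_ge0// lee_fin.
by rewrite -[leLHS]mul1e lee_wpmul2r// lee_fin ler1n.
Qed.

(** With al = |a| the modulus is (r - al) / (1 - r al), whose distance to 1 is (1 + al) (1 - r) / (1
    - r al). *)
Lemma moebius_radial a r : a != 0 -> disc a -> modulus a < r < 1 ->
  modulus (moebius a ((r / modulus a)%:C%C * a)) <= 1 - (1 + modulus a) * (1 - r).
Proof.
rewrite -modulus_gt0 /disc/= => a0 a1 /andP[ar r1].
set x := r / modulus a; set al := modulus a in a0 a1 ar x *.
have den : 1 - a^*%C * (x%:C%C * a) = (1 - r * al)%:C%C.
  rewrite (_ : r * al = x * al ^+ 2); last by rewrite /x; field; rewrite gt_eqF.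
  rewrite /al sqr_modulus; move: (x) => y; case: (a) => u v.
  by apply/eqP; rewrite eq_complex /=; apply/andP; split; apply/eqP; ring.
have num : a - x%:C%C * a = (1 - x)%:C%C * a by rewrite rmorphB rmorph1 mulrBl mul1r.
have d0 : 0 < 1 - r * al by nra.
rewrite /moebius den num !modulusM modulusV !modulus_real -/al (gtr0_norm d0).
have -> : `|1 - x| = (r - al) / al.
  rewrite distrC ger0_norm ?subr_ge0 ?ler_pdivlMr ?mul1r ?(ltW ar)//.
  by rewrite mulrBl divff// gt_eqF.
rewrite divfK ?gt_eqF// ler_pdivrMr//.
have : 0 <= (1 + al) * (1 - r) * (r * al) by rewrite !mulr_ge0; lra.
nra.
Qed.

(** With l = 1 + |a|, the bound is applied at the point of modulus 1 - l^n t on the ray through [a]: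
    its preimage has modulus at most 1 - l^(n+1) t, and [star] decreases with the modulus. The
    maximum keeps these points beyond both [r1] and |a|. *)
Lemma star_iter a omega (M r1 : R) n t : disc a -> a != 0 -> weight omega -> 0 < M ->
  counting_bound (moebius a) omega M r1 ->
  0 < t -> (1 + modulus a) ^+ n * t <= 1 - Num.max r1 ((1 + modulus a) / 2) ->
  (star omega ((1 - (1 + modulus a) ^+ n * t)%:C)%C <=
   (M ^+ n)%:E * star omega ((1 - t)%:C)%C)%E.
Proof.
move=> da an0 ow M0 bM t0; have a0 := an0; rewrite -modulus_gt0 in a0.
set l := 1 + modulus a; set r3 := Num.max _ _.
have l1 : 1 < l by rewrite ltrDl.
have r3a : (1 + modulus a) / 2 <= r3 by rewrite le_max lexx orbT.
have r31 : r1 <= r3 by rewrite le_max lexx.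
have a1 : modulus a < 1 by exact: da.
elim: n => [|n IH] nt; first by rewrite !expr0 mul1r mul1e.
have ln0 : 0 < l ^+ n by rewrite exprn_gt0; lra.
have {}IH := IH _.
have lnt : l * (l ^+ n * t) <= 1 - r3 by rewrite mulrA -exprS.
have lnt' : 0 < l ^+ n * t by rewrite mulr_gt0.
have nt' : l ^+ n * t <= 1 - r3 by nra.
pose r := 1 - l ^+ n * t.
have ra : modulus a < r < 1 by rewrite /r; lra.
pose z := (r / modulus a)%:C%C * a.
have zr : modulus z = r.
  by rewrite modulusM modulus_real ger0_norm ?divfK ?gt_eqF// divr_ge0//; lra.
have dz : disc z by rewrite /disc/= zr; lra.
have za : z != a by apply/eqP => zaE; move: zr; rewrite zaE; lra.
have mz := moebius_radial an0 da ra.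
apply: (@le_trans _ _ (star omega (moebius a z))).
  apply: le_star => //; first by rewrite moebius_eq0// eq_sym.
  rewrite (le_trans mz)// modulus_real (le_trans _ (ler_norm _))//.
  by rewrite /r exprS -/l; lra.
apply: le_trans (star_le_nevanlinna da ow dz za) _.
apply: le_trans (bM z dz _ _) _; first by rewrite moebius0.
  by rewrite zr /r; lra.
rewrite exprS EFinM -muleA; apply: lee_wpmul2l; first by rewrite lee_fin ltW.
rewrite (@star_modulus _ z ((r)%:C)%C); first exact: IH.
by rewrite zr modulus_real ger0_norm//; lra.
Qed.

Lemma counting_bound_Dhat a omega (M r1 : R) : disc a -> a != 0 ->
  radial_weight omega -> hat_nondegenerate omega -> 0 < M -> 0 < r1 < 1 ->
  counting_bound (moebius a) omega M r1 -> Dhat omega.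
Proof.
move=> da an0 owr nd M0 /andP[r10 r11] bM; split=> //; have [ow _] := owr.
have a0 := an0; rewrite -modulus_gt0 in a0.
have a1 : modulus a < 1 by exact: da.
(* n steps multiply the distance to the circle by L >= 4, which is enough to pass from 1 - t to 1 -
   4 t. *)
have [n n4] := expr_unbounded 4 a0.
pose r3 := Num.max r1 ((1 + modulus a) / 2).
have r31 : r3 < 1 by rewrite gt_max r11/=; lra.
have r30 : 0 < r3 by rewrite lt_max r10.
set L := (1 + modulus a) ^+ n in n4.
(* The largest [t] allowed by [star_iter]; it is below 1/4 as L >= 4 and r3 > 0. *)
pose t0 := (1 - r3) / L.
have L0 : 0 < L by lra.
have t00 : 0 < t0 by rewrite divr_gt0// subr_gt0.
have t0L : L * t0 = 1 - r3 by rewrite mulrC divfK// gt_eqF.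
have t04 : t0 < 4^-1 by nra.
have Mn : 0 < M ^+ n by rewrite exprn_gt0.
(* The chain is t hat (1 - 2 t) <= star (1 - 4 t) <= star (1 - L t) <= M^n star (1 - t) <= 2 M^n t
   hat (1 - t), then divided by [t]. *)
have small t : 0 < t -> t <= t0 ->
    (hat omega (1 - 2 * t) <= (2 * M ^+ n)%:E * hat omega (1 - t))%E.
  move=> tp tt0; have Lt : L * t <= 1 - r3 by rewrite -t0L ler_pM2l.
  have realm (x : R) : 0 < x -> x < 1 ->
      [/\ modulus (x%:C%C : R[i]) = x, disc (x%:C%C : R[i]) & (x%:C%C : R[i]) != 0].
    move=> x0 x1; have xE : modulus (x%:C%C : R[i]) = x by rewrite modulus_real gtr0_norm.
    by rewrite -modulus_gt0 /disc /mkset xE.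
  have t4 : t < 4^-1 by lra.
  have [|//|E1 D1 N1] := realm (1 - t); rewrite ?gtrBl//; first lra.
  have [||E4 D4 N4] := realm (1 - 4 * t); [lra|lra|].
  have [||EL DL NL] := realm (1 - L * t); [lra|nra|].
  have hs := hat_le_star ow D4 N4; rewrite E4 in hs.
  have halfE : (1 + (1 - 4 * t)) / 2 = 1 - 2 * t by field.
  have quarterE : (1 - (1 - 4 * t)) / 4 = t by field.
  rewrite {}halfE {}quarterE in hs.
  have LE : modulus (1 - L * t)%:C%C <= modulus (1 - 4 * t)%:C%C.
    by rewrite EL E4 lerB// ler_pM2r.
  have := le_trans (le_trans hs (le_star ow NL LE)) (star_iter da an0 ow M0 bM tp Lt).
  have := star_le_hat ow D1 N1; rewrite E1 => sh.
  have l2 : ln (1 - t)^-1 <= 2 * t.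
    by apply: le_trans (ln_inv_le _ _) _; lra.
  have [|h1E h1] := @fine_hat omega (1 - t) nd; first by lra.
  have [|h2E h2] := @fine_hat omega (1 - 2 * t) nd; first by lra.
  have : ((M ^+ n)%:E * star omega (1 - t)%:C%C <=
     (M ^+ n)%:E * ((2 * t)%:E * hat omega (1 - t)))%E.
    apply: lee_wpmul2l; first by rewrite lee_fin ltW.
    apply: le_trans sh _; apply: lee_wpmul2r; first by rewrite h1E lee_fin ltW.
    by rewrite lee_fin.
  move=> /[swap]/le_trans/[apply].
  rewrite h1E h2E -!EFinM !lee_fin => H.
  rewrite -(ler_pM2l tp); apply: le_trans H _.
  by rewrite [leRHS](_ : _ = M ^+ n * (2 * t * fine (hat omega (1 - t)))); last by ring.
have [h0E h0] : hat omega 0 = (fine (hat omega 0))%:E /\ 0 < fine (hat omega 0).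
  by apply: fine_hat => //; rewrite lexx ltr01.
have [|h1E h1] := @fine_hat omega (1 - t0) nd; first by lra.
set H0 := fine _ in h0E h0; set H1 := fine _ in h1E h1.
(* The first summand serves t <= t0. For t > t0, monotonicity gives hat omega r <= H0 and H1 <= hat
   omega (1 - t). *)
exists (2 * M ^+ n + H0 / H1); first by rewrite addr_gt0 ?divr_gt0 ?mulr_gt0.
move=> r /andP[rp r1']; pose t := (1 - r) / 2.
have tp : 0 < t by rewrite divr_gt0// subr_gt0.
have rE : (1 + r) / 2 = 1 - t by rewrite /t; field.
have h0r : (0 <= hat omega (1 - t))%E by apply: hat_ge0 => //; rewrite /t; lra.
rewrite rE; have [tt0|t0t] := leP t t0.
  have -> : r = 1 - 2 * t by rewrite /t; field.
  apply: le_trans (small t tp tt0) _; apply: lee_wpmul2r => //.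
  by rewrite lee_fin lerDl divr_ge0// ltW.
apply: (@le_trans _ _ (hat omega 0)); first exact: le_hat.
apply: (@le_trans _ _ ((H0 / H1)%:E * hat omega (1 - t))%E); last first.
  by apply: lee_wpmul2r => //; rewrite lee_fin lerDr mulr_ge0// ltW.
apply: (@le_trans _ _ ((H0 / H1)%:E * hat omega (1 - t0))%E); last first.
  apply: lee_wpmul2l; first by rewrite lee_fin divr_ge0// ltW.
  by apply: le_hat => //; rewrite /t; lra.
by rewrite h0E h1E -EFinM divfK// gt_eqF.
Qed.

End Main.

(** [r0] is chosen before [omega], so it depends on [phi] alone. The condition a != 0 excludes z |->
    -z, for which the bound holds for every radial weight. *)
Theorem proposition17 (R : realType) :
  exists r0 : (R[i] -> R[i]) -> R,
    (forall phi : R[i] -> R[i], analytic_self_map phi -> 0 < r0 phi < 1) /\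
    forall omega : R[i] -> R, radial_weight omega -> hat_nondegenerate omega ->
      [<-> Dhat omega;
           forall phi : R[i] -> R[i], analytic_self_map phi ->
             exists2 M : R, 0 < M & counting_bound phi omega M (r0 phi);
           exists a : R[i], [/\ disc a, a != 0 &
             exists M r1 : R,
               [/\ 0 < M, 0 < r1 < 1 & counting_bound (moebius a) omega M r1]]].
Proof.
exists radius; split=> [phi|omega ow nd]; first exact: radius_itv.
tfae.
- by move=> oD phi phiA; exact: Dhat_counting_bound.
(* Any nonzero point of the disc would serve. *)
- move=> bnd; pose a : R[i] := (2^-1)%:C%C.
  have aE : modulus a = 2^-1 by rewrite modulus_real gtr0_norm ?invr_gt0.
  have da : disc a by rewrite /disc /mkset aE; lra.
  have [M M0 bM] := bnd _ (moebius_self_map da).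
  exists a; split=> //; first by rewrite -modulus_gt0 aE invr_gt0.
  exists M, (radius (moebius a)); split=> //.
  exact/radius_itv/moebius_self_map.
- by move=> [a [da a0 [M [r1 [M0 r1P bM]]]]]; exact: counting_bound_Dhat bM.
Qed.
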